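(* Let $A$ be a finite dimensional basic algebra over a field $K$. Let $(U,Q)$ be a basic $\tau$-rigid pair in $\mathsf{mod}\,A$ and let $(M,P)$ be the absolute right Bongartz completion of $(U,Q)$, i.e. the basic $\tau$-tilting pair with $\mathsf{Fac}\,M={}^\bot(\tau U)\cap Q^\bot$. Let $B=\mathrm{End}_A(M)$ and let $A_{(U,Q)}=B/Be_UB$ be the $\tau$-tilting reduction of $A$ at $(U,Q)$. If $\mathsf{Fac}\,M={}^\bot(\tau U)\cap Q^\bot$ has a maximal green sequence in $\mathsf{mod}\,A$, then the algebra $A_{(U,Q)}$ has a maximal green sequence.
   Context: $\mathsf{mod}\,A$ is the category of finitely generated right $A$-modules and $\tau$ is the Auslander–Reiten translation. All subcategories are full and closed under isomorphisms. For a subcategory (or object) $\mathcal X$: $\mathcal X^\bot=\{C\mid \mathrm{Hom}_A(\mathcal X,C)=0\}$, ${}^\bot\mathcal X=\{C\mid \mathrm{Hom}_A(C,\mathcal X)=0\}$; $\mathsf{Fac}\,\mathcal X$ consists of the factor modules of modules in the additive closure $\mathsf{add}\,\mathcal X$. $|M|$ is the number of non-isomorphic indecomposable direct summands of $M$. A pair $(M,P)$ with $M\in\mathsf{mod}\,A$ and $P$ projective is $\tau$-rigid if $\mathrm{Hom}_A(M,\tau M)=0$ and $\mathrm{Hom}_A(P,M)=0$; a $\tau$-rigid pair is $\tau$-tilting if $|M|+|P|=|A|$. It is basic if both $M$ and $P$ are basic. Pairs are considered up to isomorphism. Known (Adachi–Iyama–Reiten): $(M,P)\mapsto\mathsf{Fac}\,M$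 is a bijection from basic $\tau$-tilting pairs to functorially finite torsion classes in $\mathsf{mod}\,A$, and ${}^\bot(\tau U)\cap Q^\bot$ is a functorially finite torsion class; the corresponding pair $(M,P)$ is the absolute right Bongartz completion of $(U,Q)$. It has $P=Q$ and $M=U\oplus U'$ for some $\tau$-rigid module $U'$. The idempotent $e_U\in B=\mathrm{End}_A(M)$ is the one corresponding to the projective right $B$-module $\mathrm{Hom}_A(M,U)$ (i.e. the projection of $M=U\oplus U'$ onto $U$). A torsion class in $\mathsf{mod}\,A$ is a subcategory closed under extensions and quotients. For torsion classes $\mathcal T\subsetneq\mathcal T'$, $\mathcal T'$ is a cover of $\mathcal T$ if there is no torsion class strictly between them. A maximal green sequence for a torsion class $\mathcal T$ in $\mathsf{mod}\,A$ is a finite sequence of torsion classes $0=\mathcal T_0\subsetneq\mathcal T_1\subsetneq\dots\subsetneq\mathcal T_m=\mathcal T$ such that $\mathcal T_{i+1}$ is a cover of $\mathcal T_i$ for $i=0,\dots,m-1$. A finite dimensional algebra $\Lambda$ has a maximal green sequence if the torsion class $\mathsf{mod}\,\Lambda$ in $\mathsf{mod}\,\Lambda$ has one. *)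

(* Defs.v *)
From HB Require Import structures.
From mathcomp Require Import all_boot all_algebra.

Set Implicit Arguments.
Unset Strict Implicit.
Unset Printing Implicit Defensive.

Import GRing.Theory.
Local Open Scope ring_scope.

(* The library's algType and falgType exclude the zero ring, but End_A(M) and *)
(* its quotients may vanish. The ring and vector space structures of such an  *)
(* algebra are attached to its carrier fdalg_sort below.                      *)
Record fdalg (K : fieldType) := FdAlg {
  fdalg_space : vectType K;
  fdalg_mul : fdalg_space -> fdalg_space -> fdalg_space;
  fdalg_one : fdalg_space;
  fdalg_mulA : associative fdalg_mul;
  fdalg_mul1l : left_id fdalg_one fdalg_mul;
  fdalg_mul1r : right_id fdalg_one fdalg_mul;
  fdalg_linearl : forall b, linear (fdalg_mul^~ b);
  fdalg_linearr : forall a, linear (fdalg_mul a)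
}.

Definition fdalg_sort (K : fieldType) (A : fdalg K) : Type := fdalg_space A.
Coercion fdalg_sort : fdalg >-> Sortclass.

Section FdAlgTheory.
Variables (K : fieldType) (A : fdalg K).

HB.instance Definition _ := Vector.copy (fdalg_sort A) (fdalg_space A).

Let mulDl : left_distributive (@fdalg_mul K A) +%R.
Proof. by move=> x y z; have := fdalg_linearl z 1 x y; rewrite !scale1r. Qed.

Let mulDr : right_distributive (@fdalg_mul K A) +%R.
Proof. by move=> x y z; have := fdalg_linearr x 1 y z; rewrite !scale1r. Qed.

HB.instance Definition _ := GRing.Zmodule_isPzRing.Build (fdalg_sort A)
  (@fdalg_mulA K A) (@fdalg_mul1l K A) (@fdalg_mul1r K A) mulDl mulDr.

Lemma fdalg_mul_linearl (b : A) : linear (fun a : A => a * b).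
Proof. exact: fdalg_linearl. Qed.

Lemma fdalg_mul_linearr (a : A) : linear (fun b : A => a * b).
Proof. exact: fdalg_linearr. Qed.

Definition lmulA (a b : A) : A := a * b.
Definition rmulA (b a : A) : A := a * b.

HB.instance Definition _ (a : A) :=
  GRing.isLinear.Build K A A _ (lmulA a) (fdalg_mul_linearr a).
HB.instance Definition _ (b : A) :=
  GRing.isLinear.Build K A A _ (rmulA b) (fdalg_mul_linearl b).

Lemma fdalg_scaleAl (k : K) (a b : A) : k *: (a * b) = (k *: a) * b.
Proof. exact/esym/(linearZ_LR (rmulA b)). Qed.

Lemma fdalg_scaleAr (k : K) (a b : A) : k *: (a * b) = a * (k *: b).
Proof. exact/esym/(linearZ_LR (lmulA a)). Qed.

Definition opalg : fdalg K :=
  @FdAlg K (fdalg_space A) (fun a b => fdalg_mul b a) (fdalg_one A)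
    (fun a b c => esym (fdalg_mulA c b a)) (@fdalg_mul1r K A)
    (@fdalg_mul1l K A) (@fdalg_linearr K A) (@fdalg_linearl K A).

End FdAlgTheory.

(* Finite dimensional right modules; over a finite dimensional algebra these  *)
(* are the finitely generated ones. Left A-modules are rmod (opalg A).        *)
Record rmod (K : fieldType) (A : fdalg K) := RMod {
  rmod_sort :> vectType K;
  ract : rmod_sort -> A -> rmod_sort;
  ract_linearl : forall a, linear (ract^~ a);
  ract_linearr : forall x, linear (ract x);
  ractM : forall x a b, ract x (a * b) = ract (ract x a) b;
  ract1 : forall x, ract x 1 = x
}.

Section Homs.
Variables (K : fieldType) (A : fdalg K).
Implicit Types M N L : rmod A.

HB.instance Definition _ M (x : M) :=
  GRing.isLinear.Build K A M _ (@ract K A M x) (@ract_linearr K A M x).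

Definition ractr M (a : A) (x : M) : M := ract x a.

HB.instance Definition _ M (a : A) :=
  GRing.isLinear.Build K M M _ (@ractr M a) (@ract_linearl K A M a).

Definition ractf M (a : A) : 'End(M) := linfun (@ractr M a).

Lemma ractfE M a x : ractf M a x = ract x a.
Proof. by rewrite lfunE. Qed.

Definition homdef M N (a : A) (f : 'Hom(M, N)) : 'Hom(M, N) :=
  (f \o ractf M a)%VF - (ractf N a \o f)%VF.

Fact homdef_linear M N a : linear (@homdef M N a).
Proof.
move=> k f g; rewrite /homdef comp_lfunDl comp_lfunDr -comp_lfunZl -comp_lfunZr.
by rewrite opprD addrACA scalerBr.
Qed.
HB.instance Definition _ M N a :=
  GRing.isLinear.Build K 'Hom(M, N) 'Hom(M, N) _ (@homdef M N a)
    (@homdef_linear M N a).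

(* Hom_A(M, N), cut out of Hom_K(M, N) by the equations for a basis of A; see *)
(* homAP.                                                                     *)
Definition homA M N : {vspace 'Hom(M, N)} :=
  (\bigcap_(i < \dim {: fdalg_sort A})
     lker (linfun (@homdef M N (vbasis {: fdalg_sort A})`_i)))%VS.

Lemma homdefE M N a (f : 'Hom(M, N)) x :
  homdef a f x = f (ract x a) - ract (f x) a.
Proof. by rewrite !lfunE /= !lfunE /= !lfunE /= !ractfE. Qed.

Lemma homAP M N (f : 'Hom(M, N)) :
  reflect (forall x a, f (ract x a) = ract (f x) a) (f \in homA M N).
Proof.
rewrite /homA memvE; apply: (iffP subv_bigcapP) => /= [h x a | h i _].
  have hb (i : 'I_(\dim {: fdalg_sort A})) y :
      f (ract y (vbasis {:fdalg_sort A})`_i)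
      = ract (f y) (vbasis {:fdalg_sort A})`_i.
    have := h i isT; rewrite -memvE memv_ker lfunE /= => /eqP e.
    by apply/eqP; rewrite -subr_eq0 -homdefE e lfunE.
  rewrite (coord_vbasis (memvf a)) !linear_sum /=.
  by apply: eq_bigr => i _; rewrite !linearZ /= hb.
rewrite -memvE memv_ker lfunE /=; apply/eqP/lfunP => x.
by rewrite homdefE h subrr lfunE.
Qed.

Lemma homA_id M : \1%VF \in homA M M.
Proof. by apply/homAP => x a; rewrite !lfunE. Qed.

Lemma homA_comp M N L (f : 'Hom(M, N)) (g : 'Hom(N, L)) :
  f \in homA M N -> g \in homA N L -> (g \o f)%VF \in homA M L.
Proof.
by move=> /homAP hf /homAP hg; apply/homAP => x a; rewrite !lfunE /= hf hg.
Qed.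

End Homs.

Section ModuleConstructions.
Variables (K : fieldType) (A : fdalg K).
Implicit Types M N : rmod A.

Definition regmod : rmod A :=
  @RMod K A (fdalg_sort A) (fun x a => x * a) (@fdalg_mul_linearl K A)
    (@fdalg_mul_linearr K A) (@mulrA A) (@mulr1 A).

Definition zeromod : rmod A.
Proof.
have h (u v : 'rV[K]_0) : u = v by apply/rowP => -[].
exact: (@RMod K A 'rV[K]_0 (fun x _ => x) (fun _ _ _ _ => h _ _)
  (fun _ _ _ _ => h _ _) (fun _ _ _ => h _ _) (fun _ => h _ _)).
Defined.

Definition dsum M N : rmod A.
Proof.
refine (@RMod K A (M * N)%type (fun x a => (ract x.1 a, ract x.2 a)) _ _ _ _).
- by move=> a k [x1 x2] [y1 y2] /=; rewrite !ract_linearl.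
- by move=> [x1 x2] k a b /=; rewrite !ract_linearr.
- by move=> [x1 x2] a b /=; rewrite !ractM.
- by move=> [x1 x2] /=; rewrite !ract1.
Defined.

(* D = Hom_K(-, K), from left to right A-modules.                             *)
Definition dualmod (T : rmod (opalg A)) : rmod A.
Proof.
refine (@RMod K A 'Hom(T, K^o)
  (fun phi a => (phi \o ractf T (a : opalg A))%VF) _ _ _ _).
- by move=> a k f g; rewrite comp_lfunDl -comp_lfunZl.
- move=> f k a b; apply/lfunP=> x; rewrite !lfunE /= !lfunE /= !lfunE /=.
  rewrite !ractfE; apply: (etrans (congr1 f (@ract_linearr K _ T x k a b))).
  exact: (linearP f).
- move=> f a b; apply/lfunP=> x; rewrite !lfunE /= !lfunE /= !ractfE.
  by rewrite -ractM.
- by move=> f; apply/lfunP=> x; rewrite lfunE /= ractfE [ract _ _]ract1.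
Defined.

End ModuleConstructions.

Section HomStructures.
Variables (K : fieldType) (A : fdalg K).
Implicit Types M N : rmod A.

(* The left A-module Hom_A(P, A), with (phi a)(x) = a * phi x.                *)
Fact starmod_subproof (P : rmod A) (a : A) (phi : 'Hom(P, regmod A)) :
  phi \in homA P (regmod A) ->
  (linfun (lmulA a) \o phi)%VF \in homA P (regmod A).
Proof.
move=> /homAP h; apply/homAP => x b; rewrite !lfunE /= !lfunE /= h.
by rewrite /lmulA /= mulrA.
Qed.

Definition starmod (P : rmod A) : rmod (opalg A).
Proof.
refine (@RMod K (opalg A) (subvs_of (homA P (regmod A)))
  (fun phi a => Subvs (starmod_subproof (a : A) (subvsP phi))) _ _ _ _).
- by move=> a k f g; apply/val_inj; rewrite /= comp_lfunDr -comp_lfunZr.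
- move=> f k a b; apply/val_inj/lfunP => x /=.
  by rewrite !lfunE /= !lfunE /= !lfunE /= [LHS]fdalg_mul_linearl !lfunE.
- move=> f a b; apply/val_inj/lfunP => x /=.
  by rewrite !lfunE /= !lfunE /= lfunE; apply/esym/(@mulrA A).
- move=> f; apply/val_inj/lfunP => x /=.
  by rewrite !lfunE /= !lfunE /= [LHS]mul1r.
Defined.

(* Hom_A(f, A); see starmapE.                                                 *)
Definition starfun (P1 P0 : rmod A) (f : 'Hom(P1, P0)) (phi : starmod P0) :
    starmod P1 :=
  vsproj (homA P1 (regmod A)) (vsval phi \o f)%VF.

Fact starfun_linear (P1 P0 : rmod A) (f : 'Hom(P1, P0)) : linear (@starfun P1 P0 f).
Proof.
move=> k u v; rewrite /starfun -linearP /=; congr (vsproj _ _).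
by rewrite comp_lfunDl -comp_lfunZl.
Qed.
HB.instance Definition _ (P1 P0 : rmod A) (f : 'Hom(P1, P0)) :=
  GRing.isLinear.Build K (starmod P0) (starmod P1) _ (@starfun P1 P0 f)
    (@starfun_linear P1 P0 f).

Definition starmap (P1 P0 : rmod A) (f : 'Hom(P1, P0)) : 'Hom(starmod P0, starmod P1) :=
  linfun (@starfun P1 P0 f).

Lemma starmapE (P1 P0 : rmod A) (f : 'Hom(P1, P0)) phi : f \in homA P1 P0 ->
  vsval (starmap f phi) = (vsval phi \o f)%VF.
Proof.
move=> hf; rewrite lfunE /= vsprojK //; apply: (@homA_comp K A P1 P0 (regmod A)) => //.
exact: (subvsP (phi : subvs_of (homA P0 (regmod A)))).
Qed.

(* End_A(M), with composition as product: M is a left End_A(M)-module.        *)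
Definition endalg M : fdalg K.
Proof.
refine (@FdAlg K (subvs_of (homA M M))
  (fun f g => Subvs (homA_comp (subvsP g) (subvsP f))) (Subvs (homA_id M))
  _ _ _ _ _).
- by move=> f g h; apply/val_inj; rewrite /= comp_lfunA.
- by move=> f; apply/val_inj; rewrite /= comp_lfun1l.
- by move=> f; apply/val_inj; rewrite /= comp_lfun1r.
- by move=> f k g h; apply/val_inj; rewrite /= comp_lfunDl -comp_lfunZl.
- by move=> f k g h; apply/val_inj; rewrite /= comp_lfunDr -comp_lfunZr.
Defined.

End HomStructures.

Section Quotient.
Variables (K : fieldType) (B : fdalg K) (e : B).
Local Notation d := (\dim {: fdalg_sort B}).
Local Notation b := (vbasis {: fdalg_sort B}).

(* The two-sided ideal B e B.                                                 *)
Definition ideal_gen : {vspace fdalg_sort B} :=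
  (\sum_(p : 'I_d * 'I_d) <[b`_p.1 * e * b`_p.2]>)%VS.

Lemma mul_ideal_gen u v : u * e * v \in ideal_gen.
Proof.
rewrite (coord_vbasis (memvf u)) (coord_vbasis (memvf v)).
rewrite !mulr_suml; apply: memv_suml => i _.
rewrite mulr_sumr; apply: memv_suml => j _.
set k := coord _ i u; set l := coord _ j v.
have -> : k *: b`_i * e * (l *: b`_j) = (k * l) *: (b`_i * e * b`_j).
  by rewrite -fdalg_scaleAr -!fdalg_scaleAl scalerA mulrC.
by rewrite memvZ // memvE (sumv_sup (i, j)).
Qed.

Lemma memv_ideal_gen x :
  x \in ideal_gen <->
  exists (n : nat) (u v : 'I_n -> B), x = \sum_(i < n) u i * e * v i.
Proof.
split=> [/memv_sumP[y hy ->] | [n [u [v ->]]]]; last first.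
  by apply: memv_suml => i _; apply: mul_ideal_gen.
have /fin_all_exists[k hk] p : exists k, y p = k *: (b`_p.1 * e * b`_p.2).
  exact/vlineP/hy.
pose w (i : 'I_#|{: 'I_d * 'I_d}|) : 'I_d * 'I_d := enum_val i.
exists #|{: 'I_d * 'I_d}|, (fun i => k (w i) *: b`_(w i).1),
  (fun i => b`_(w i).2).
rewrite (reindex w) /=; last by apply/onW_bij/enum_val_bij.
by apply: eq_bigr => i _; rewrite hk !fdalg_scaleAl.
Qed.

Lemma ideal_gen_mul x u v : x \in ideal_gen -> u * x * v \in ideal_gen.
Proof.
move=> /memv_ideal_gen[n [s [t ->]]]; apply/memv_ideal_gen.
exists n, (fun i => u * s i), (fun i => t i * v).
by rewrite mulr_sumr mulr_suml; apply: eq_bigr => i _; rewrite !mulrA.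
Qed.

(* B/BeB, realised on the complement of BeB: the class of x is represented by *)
(* the projection of x to that complement along BeB.                          *)
Definition quotfun (x : B) : subvs_of (ideal_gen^C)%VS :=
  Subvs (memv_projC ideal_gen x).

Fact quotfun_linear : linear quotfun.
Proof.
by move=> k x y; apply/val_inj; rewrite /= linearP opprD addrACA scalerBr.
Qed.
HB.instance Definition _ :=
  GRing.isLinear.Build K B (subvs_of (ideal_gen^C)%VS) _ quotfun quotfun_linear.

Lemma quotfun_eq0 x : (quotfun x == 0) = (x \in ideal_gen).
Proof.
apply/eqP/idP => [/(congr1 vsval)/= /subr0_eq -> | h]; first exact: memv_proj.
by apply/val_inj; rewrite /= projv_id // subrr.
Qed.

Lemma quotfunP x y : reflect (quotfun x = quotfun y) (x - y \in ideal_gen).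
Proof. by rewrite -quotfun_eq0 linearB subr_eq0; apply: eqP. Qed.

Lemma quotfunK (q : subvs_of (ideal_gen^C)%VS) : quotfun (vsval q) = q.
Proof.
apply/val_inj => /=; suff /eqP -> : projv ideal_gen (vsval q) == 0.
  by rewrite subr0.
by rewrite -memv_ker lker_proj subvsP.
Qed.

Let quotmul (p q : subvs_of (ideal_gen^C)%VS) := quotfun (vsval p * vsval q).

Lemma quotfunM x y : quotfun (x * y) = quotmul (quotfun x) (quotfun y).
Proof.
apply/quotfunP.
have hx : x - vsval (quotfun x) \in ideal_gen by apply/quotfunP; rewrite quotfunK.
have hy : y - vsval (quotfun y) \in ideal_gen by apply/quotfunP; rewrite quotfunK.
rewrite -[x * y](subrK (vsval (quotfun x) * y)) -mulrBl -addrA -mulrBr.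
have := memvD (ideal_gen_mul 1 y hx) (ideal_gen_mul (vsval (quotfun x)) 1 hy).
by rewrite mul1r mulr1.
Qed.

Definition quotalg : fdalg K.
Proof.
refine (@FdAlg K (subvs_of (ideal_gen^C)%VS) quotmul (quotfun 1) _ _ _ _ _).
- move=> p q r; rewrite -(quotfunK p) -(quotfunK q) -(quotfunK r).
  by rewrite -!quotfunM mulrA.
- by move=> q; rewrite -(quotfunK q) -quotfunM mul1r.
- by move=> q; rewrite -(quotfunK q) -quotfunM mulr1.
- move=> q k x y; rewrite /quotmul -linearP; congr quotfun.
  exact: fdalg_mul_linearl.
- move=> q k x y; rewrite /quotmul -linearP; congr quotfun.
  exact: fdalg_mul_linearr.
Defined.
End Quotient.

Section ModuleNotions.
Variables (K : fieldType) (A : fdalg K).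
Implicit Types M N X Y Z P U : rmod A.

Definition is_zero M := fullv = 0%VS :> {vspace M}.

Definition iso M N :=
  exists f : 'Hom(M, N), [/\ f \in homA M N, lker f = 0%VS & limg f = fullv].

Definition summand N M := exists L : rmod A, iso M (dsum N L).

Definition indecomposable M :=
  ~ is_zero M /\
  forall X Y, iso M (dsum X Y) -> is_zero X \/ is_zero Y.

Definition basic M :=
  exists (n : nat) (X : 'I_n -> rmod A),
    [/\ forall i, indecomposable (X i),
        forall i j, i != j -> ~ iso (X i) (X j)
      & iso M (\big[@dsum K A/zeromod A]_(i < n) X i)].

(* |M| = n *)
Definition num_summands M (n : nat) :=
  exists X : 'I_n -> rmod A,
    [/\ forall i, indecomposable (X i) /\ summand (X i) M,
        forall i j, i != j -> ~ iso (X i) (X j)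
      & forall N, indecomposable N -> summand N M -> exists i, iso N (X i)].

(* Full subcategories of mod A, compared extensionally.                       *)
Definition subcat := rmod A -> Prop.
Implicit Types S T : subcat.

Definition subcat_le S T := forall X, S X -> T X.
Definition subcat_eq S T := forall X, S X <-> T X.
Definition subcat_lt S T := subcat_le S T /\ ~ subcat_le T S.

Definition add M : subcat := fun N =>
  exists n : nat, summand N (\big[@dsum K A/zeromod A]_(i < n) M).

Definition Fac M : subcat := fun C =>
  exists N (f : 'Hom(N, C)), [/\ add M N, f \in homA N C & limg f = fullv].

(* M^bot and ^bot M *)
Definition perpr M : subcat := fun C => homA M C = 0%VS.
Definition perpl M : subcat := fun C => homA C M = 0%VS.

Definition projective P :=
  forall X Y (g : 'Hom(X, Y)) (f : 'Hom(P, Y)),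
    g \in homA X Y -> limg g = fullv -> f \in homA P Y ->
    exists2 h, h \in homA P X & (g \o h)%VF = f.

Definition submodule M (W : {vspace M}) :=
  forall x (a : A), x \in W -> ract x a \in W.

Definition superfluous M (V : {vspace M}) :=
  forall W : {vspace M}, submodule W -> (V + W)%VS = fullv -> W = fullv.

(* p : P -> X corestricts to a projective cover P -> V of the submodule V. *)
Definition projective_cover P X (p : 'Hom(P, X)) (V : {vspace X}) :=
  [/\ projective P, p \in homA P X, limg p = V & superfluous (lker p)].

(* P1 -f-> P0 -p-> M -> 0 *)
Definition minimal_presentation P1 P0 M (f : 'Hom(P1, P0)) (p : 'Hom(P0, M)) :=
  projective_cover p fullv /\ projective_cover f (lker p).

(* T is Tr M, the cokernel of Hom_A(f, A) for a minimal projective            *)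
(* presentation f of M.                                                       *)
Definition is_transpose M (T : rmod (opalg A)) :=
  exists (P1 P0 : rmod A) (f : 'Hom(P1, P0)) (p : 'Hom(P0, M)),
    minimal_presentation f p /\
    exists q : 'Hom(starmod P1, T),
      [/\ q \in homA (starmod P1) T, limg q = fullv
        & lker q = limg (starmap f)].

(* N is tau M = D Tr M; it is determined by M up to isomorphism.              *)
Definition is_tau M N := exists2 T, is_transpose M T & iso N (dualmod T).

(* ^bot (tau U) *)
Definition perpl_tau U : subcat := fun C => exists2 N, is_tau U N & perpl N C.

Definition tau_rigid_pair M P :=
  [/\ projective P, perpl_tau M M & perpr P M].

Definition tau_tilting_pair M P :=
  tau_rigid_pair M P /\
  exists m p, [/\ num_summands M m, num_summands P p
    & num_summands (regmod A) (m + p)%N].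

Definition right_bongartz_completion U Q M P :=
  [/\ tau_tilting_pair M P, basic M, basic P
    & forall C, Fac M C <-> perpl_tau U C /\ perpr Q C].

(* e is the projection of M onto a direct summand isomorphic to U.            *)
Definition summand_idempotent U M (e : endalg M) :=
  exists (i : 'Hom(U, M)) (p : 'Hom(M, U)),
    [/\ i \in homA U M, p \in homA M U, (p \o i)%VF = \1%VF
      & vsval e = (i \o p)%VF].

(* T contains 0 and is closed under quotients and extensions; closure under   *)
(* isomorphism is a special case of closure under quotients.                  *)
Definition torsion_class T :=
  [/\ forall X, is_zero X -> T X,
      forall X Y (f : 'Hom(X, Y)),
        f \in homA X Y -> limg f = fullv -> T X -> T Y
    & forall X Y Z (f : 'Hom(X, Y)) (g : 'Hom(Y, Z)),
        f \in homA X Y -> g \in homA Y Z ->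
        lker f = 0%VS -> limg f = lker g -> limg g = fullv ->
        T X -> T Z -> T Y].

Definition torsion_cover T T' :=
  subcat_lt T T' /\
  ~ exists S, [/\ torsion_class S, subcat_lt T S & subcat_lt S T'].

Definition has_maximal_green_sequence T :=
  exists (m : nat) (c : nat -> subcat),
    [/\ subcat_eq (c 0%N) is_zero, subcat_eq (c m) T,
        forall i, (i <= m)%N -> torsion_class (c i)
      & forall i, (i < m)%N -> torsion_cover (c i) (c i.+1)].

End ModuleNotions.

Definition basic_alg (K : fieldType) (A : fdalg K) := basic (regmod A).

Definition alg_has_maximal_green_sequence (K : fieldType) (A : fdalg K) :=
  has_maximal_green_sequence (fun _ : rmod A => True).

(* A_(U,Q) = B/BeB for B = End_A(M) and e = e_U *)
Definition tau_tilting_reduction (K : fieldType) (A : fdalg K) (M : rmod A)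
  (e : endalg M) : fdalg K := quotalg e.

(* Main.v *)
(* Write T = Fac M and let W be the category of those X in T with             *)
(* Hom(U, X) = 0. Two properties of T carry the proof. First, M has no        *)
(* self-extensions by modules of T, so maps from M lift along any map whose   *)
(* kernel lies in T. Second, since T is the intersection of ^bot(tau U) and   *)
(* Q^bot, the kernel of g : Y -> Z lies in T as soon as Y does and every map  *)
(* U -> Z with image in that of g lifts to Y. It follows that Hom_A(M, -)     *)
(* identifies W with the right modules over B/BeB (Jasso).                    *)
(*   Every torsion class T_i of the given sequence then induces the torsion   *)
(* class D_i of the B/BeB-modules corresponding to T_i /\ W. A torsion class  *)
(* S strictly above D_i inside D_{i+1} is D_{i+1}: otherwise some nonzero     *)
(* X' in T_{i+1} /\ W corresponds to an S-torsion-free module, the modules of *)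
(* T_{i+1} without nonzero maps to X' form a torsion class strictly above     *)
(* T_i, so it is T_{i+1}, which contains X', a contradiction. Removing        *)
(* repetitions from the D_i yields the maximal green sequence.                *)
From HB Require Import structures.
Require Import Defs.
From mathcomp Require Import all_boot all_algebra.
From Stdlib Require Import Classical.

Set Implicit Arguments.
Unset Strict Implicit.
Unset Printing Implicit Defensive.

Import GRing.Theory.
Local Open Scope ring_scope.

(** By Jasso reduction the modules over $C = B/BeB$ form a copy of $W = \mathsf{Fac}\,M \cap
    U^\bot$. Intersecting with $W$ turns a torsion class inside $\mathsf{Fac}\,M$ into a torsion
    class of $C$-modules, and a cover into an equality or a cover.

    [tau_presentation] trades the vanishing of $\mathrm{Hom}(X, \tau V)$ for the surjectivity of
    $\mathrm{Hom}(f, X)$, where $f$ is a projective presentation of $V$. From this [extends_lift]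
    and [extends_kernel] derive the two properties of $\mathsf{Fac}\,M$ on which the section
    [Reduction] rests. There [corr] relates a $C$-module to an $A$-module without choosing functors:
    [corr_exists] and [corr_dense] give objects on either side, [corr_map_hom] gives functoriality,
    [corr_map_full] fullness and [corr_map_eq0] faithfulness. Torsion classes are transported by
    [corr_class_torsion] and covers by [corr_class_cover]; [weak_maximal_green_sequence] removes the
    repetitions. *)

(** * Linear algebra *)

Section LinearMaps.
Variable K : fieldType.
Implicit Types V W : vectType K.

Definition hom_of_linear V W (f : V -> W) (hf : linear f) : 'Hom(V, W) :=
  linfun (HB.pack f (GRing.isLinear.Build K V W _ f hf) : {linear V -> W}).

Lemma hom_of_linearE V W (f : V -> W) (hf : linear f) x : hom_of_linear hf x =
  f x.
Proof. by rewrite lfunE. Qed.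

Lemma limg_memv V W (f : 'Hom(V, W)) x : f x \in limg f.
Proof. by apply: memv_img; apply: memvf. Qed.

Lemma limg_full_ex V W (f : 'Hom(V, W)) y : limg f = fullv -> exists x, y = f x.
Proof.
move=> h; have : y \in limg f by rewrite h memvf.
by case/memv_imgP=> x _ ->; exists x.
Qed.

Lemma lker0_inj V W (f : 'Hom(V, W)) : lker f = 0%VS -> injective f.
Proof. by move=> h; apply/lker0P/eqP. Qed.

Lemma inj_lker0 V W (f : 'Hom(V, W)) : injective f -> lker f = 0%VS.
Proof. by move=> h; apply/eqP/lker0P. Qed.

Lemma limg_fullP V W (f : 'Hom(V, W)) : (forall y, exists x, y = f x) ->
  limg f = fullv.
Proof.
by move=> h; apply/vspaceP => y; rewrite memvf; case: (h y) => x ->;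
  apply: limg_memv.
Qed.

Fact precomp_linear V W U (f : 'Hom(V, W)) : linear (fun h : 'Hom(W, U) => (h
  \o f)%VF).
Proof. by move=> k g h; rewrite comp_lfunDl -comp_lfunZl. Qed.

Fact postcomp_linear V W U (f : 'Hom(W, U)) : linear (fun h : 'Hom(V, W) => (f
  \o h)%VF).
Proof. by move=> k g h; rewrite comp_lfunDr -comp_lfunZr. Qed.

(** The coordinates of the projection with kernel [I] are functionals vanishing on [I], and they
    detect whether [x] lies in [I]. *)
Lemma memv_functionals V (I : {vspace V}) x :
  (forall l : 'Hom(V, K^o), (forall y, y \in I -> l y = 0) -> l x = 0) ->
    x \in I.
Proof.
move=> h; suff : x - projv I x = 0.
  by move=> /eqP; rewrite subr_eq0 => /eqP ->; apply: memv_proj.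
rewrite [LHS](coord_vbasis (memvf _)) big1 // => k _.
have lk : linear (coord (vbasis (fullv : {vspace V})) k : V -> K^o).
  by move=> c u v; rewrite linearP.
have kE y : (hom_of_linear lk \o (\1 - projv I))%VF y =
    coord (vbasis (fullv : {vspace V})) k (y - projv I y).
  by rewrite comp_lfunE hom_of_linearE add_lfunE opp_lfunE id_lfunE.
rewrite -kE h ?scale0r // => y hy.
by rewrite kE projv_id // subrr linear0.
Qed.

End LinearMaps.

(** * Submodules, quotients, finite direct sums and universal maps *)

Section Modules.
Variables (K : fieldType) (A : fdalg K).
Implicit Types X Y Z V S M N L P : rmod A.

Lemma is_zeroP X : is_zero X <-> forall x : X, x = 0.
Proof.
split=> [h x|h]; first by apply/eqP; rewrite -memv0 -h memvf.
by apply/vspaceP => x; rewrite memvf [x]h mem0v.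
Qed.

Lemma homA0P X Y : homA X Y = 0%VS <-> forall f, f \in homA X Y -> f = 0.
Proof.
split=> [h f|h]; first by rewrite h memv0 => /eqP.
by apply/eqP; rewrite -subv0; apply/subvP => f /h ->; apply: mem0v.
Qed.

Lemma ract0l X (a : A) : ract (0 : X) a = 0.
Proof. exact: (linear0 (@ractr K A X a)). Qed.

Lemma ractBl X (x y : X) (a : A) : ract (x - y) a = ract x a - ract y a.
Proof. exact: (linearB (@ractr K A X a)). Qed.

Lemma ract_suml X n (x : 'I_n -> X) (a : A) :
  ract (\sum_i x i) a = \sum_i ract (x i) a.
Proof. exact: (linear_sum (@ractr K A X a)). Qed.

Lemma limg_submodule X Y (f : 'Hom(X, Y)) : f \in homA X Y ->
  submodule (limg f).
Proof.
by move=> /homAP hf _ a /memv_imgP[x _ ->]; rewrite -hf limg_memv.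
Qed.

Lemma lker_submodule X Y (f : 'Hom(X, Y)) : f \in homA X Y ->
  submodule (lker f).
Proof.
by move=> /homAP hf x a; rewrite !memv_ker hf => /eqP ->; rewrite ract0l.
Qed.

Lemma submodule_image X (W : {vspace X}) : submodule W ->
  exists S (i : 'Hom(S, X)), [/\ i \in homA S X, lker i = 0%VS & limg i = W].
Proof.
move=> hW.
have h (w : subvs_of W) (a : A) : ract (vsval w) a \in W by apply/hW/subvsP.
have h1 (a : A) : linear (fun w : subvs_of W => Subvs (h w a)).
  by move=> k u v; apply/val_inj; rewrite /= ract_linearl.
have h2 (w : subvs_of W) : linear (fun a : A => Subvs (h w a)).
  by move=> k u v; apply/val_inj; rewrite /= ract_linearr.
have h3 (w : subvs_of W) (a b : A) :
    Subvs (h w (a * b)) = Subvs (h (Subvs (h w a)) b).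
  by apply/val_inj; rewrite /= ractM.
have h4 (w : subvs_of W) : Subvs (h w 1) = w by apply/val_inj; rewrite /= ract1.
pose S := @RMod K A (subvs_of W) (fun w a => Subvs (h w a)) h1 h2 h3 h4.
exists S, (linfun (vsval : subvs_of W -> X)); split.
- by apply/homAP => x a; rewrite !lfunE.
- by apply: inj_lker0 => x y; rewrite !lfunE /=; apply: val_inj.
- apply/vspaceP => x; apply/idP/idP => [/memv_imgP[w _ ->]|hx].
    by rewrite lfunE; apply: subvsP.
  by apply/memv_imgP; exists (Subvs hx); rewrite ?memvf // lfunE.
Qed.

Lemma submodule_quotient X (W : {vspace X}) : submodule W ->
  exists Z (q : 'Hom(X, Z)), [/\ q \in homA X Z, limg q = fullv & lker q = W].
Proof.
move=> hW; pose pr (x : X) : subvs_of (W^C)%VS := Subvs (memv_projC W x).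
have prlin : linear pr.
  by move=> k x y; apply/val_inj; rewrite /= linearP opprD addrACA scalerBr.
have pr0 x : x \in W -> pr x = 0.
  by move=> hx; apply/val_inj; rewrite /= projv_id // subrr.
have prE x : exists2 w, w \in W & vsval (pr x) = x - w.
  by exists (projv W x) => //; apply: memv_proj.
have prB x y : x - y \in W -> pr x = pr y.
  move=> /pr0 h; rewrite -[x](subrK y) -[x - y]scale1r prlin h.
  by rewrite scaler0 add0r.
have prK w : pr (vsval w) = w.
  apply/val_inj => /=; suff /eqP -> : projv W (vsval w) == 0 by rewrite subr0.
  by rewrite -memv_ker lker_proj subvsP.
(* The quotient lives on a linear complement of [W], which need not be a submodule, so the action is
   followed by the projection. *)
pose act (w : subvs_of (W^C)%VS) (a : A) := pr (ract (vsval w) a).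
have actE x a : act (pr x) a = pr (ract x a).
  apply: prB; case: (prE x) => w hw ->.
  by rewrite ractBl addrAC subrr sub0r memvN; apply: hW.
have h1 (a : A) : linear (act^~ a).
  by move=> k u v; rewrite /act /= ract_linearl prlin.
have h2 (w : subvs_of (W^C)%VS) : linear (act w).
  by move=> k u v; rewrite /act /= ract_linearr prlin.
have h3 (w : subvs_of (W^C)%VS) (a b : A) : act w (a * b) = act (act w a) b.
  by rewrite -[w]prK !actE ractM.
have h4 (w : subvs_of (W^C)%VS) : act w 1 = w by rewrite /act ract1.
pose Z := @RMod K A (subvs_of (W^C)%VS) act h1 h2 h3 h4.
have qE x : hom_of_linear prlin x = pr x by rewrite hom_of_linearE.
exists Z, (hom_of_linear prlin); split.
- by apply/homAP => x a; rewrite !qE [RHS]actE.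
- by apply: limg_fullP => w; exists (vsval w); rewrite qE prK.
- apply/vspaceP => x; rewrite memv_ker qE; apply/eqP/idP => [h|/pr0 //].
  case: (prE x) => w hw; rewrite h => /esym/eqP; rewrite subr_eq0 => /eqP ->.
  exact: hw.
Qed.

Lemma hom_corestrict S X Y (i : 'Hom(S, X)) (f : 'Hom(Y, X)) :
  i \in homA S X -> lker i = 0%VS -> f \in homA Y X -> (limg f <= limg i)%VS ->
  exists2 f', f' \in homA Y S & (i \o f')%VF = f.
Proof.
move=> /homAP hi i0 /homAP hf /subvP fi.
have iK y : i ((i^-1)%VF (f y)) = f y by rewrite limg_lfunVK ?fi ?limg_memv.
exists ((i^-1) \o f)%VF; last by apply/lfunP => y; rewrite !comp_lfunE.
apply/homAP => y a; rewrite !comp_lfunE; apply: (lker0_inj i0).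
by rewrite hi !iK hf.
Qed.

Lemma hom_factor X Z Y (q : 'Hom(X, Z)) (f : 'Hom(X, Y)) :
  q \in homA X Z -> limg q = fullv -> f \in homA X Y -> (lker q <= lker f)%VS ->
  exists2 f', f' \in homA Z Y & (f' \o q)%VF = f.
Proof.
move=> /homAP hq q1 /homAP hf /subvP qf.
have qK z : q ((q^-1)%VF z) = z by rewrite limg_lfunVK // q1 memvf.
have fE x y : q x = q y -> f x = f y.
  move=> h; apply/eqP; rewrite -subr_eq0 -linearB -memv_ker qf //.
  by rewrite memv_ker linearB /= h subrr.
exists (f \o (q^-1))%VF; last first.
  by apply/lfunP => x; rewrite !comp_lfunE; apply: fE; rewrite qK.
by apply/homAP => z a; rewrite !comp_lfunE -hf; apply: fE; rewrite hq !qK.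
Qed.

(** This says that [S] is $V^n$. Working with insertions and projections avoids the iterated [dsum],
    whose last term [zeromod] is not known to be zero. *)
Definition biproduct n V S (i : 'I_n -> 'Hom(V, S)) (p : 'I_n -> 'Hom(S, V)) :=
  [/\ forall k, i k \in homA V S, forall k, p k \in homA S V,
      forall k l, (p k \o i l)%VF = if k == l then \1%VF else 0
    & (\sum_k (i k \o p k))%VF = \1%VF].

Lemma dsum_maps V S : exists (j1 : 'Hom(V, dsum V S)) (j2 : 'Hom(S, dsum V S))
    (q1 : 'Hom(dsum V S, V)) (q2 : 'Hom(dsum V S, S)),
  [/\ j1 \in homA V (dsum V S), j2 \in homA S (dsum V S),
      q1 \in homA (dsum V S) V & q2 \in homA (dsum V S) S] /\
  [/\ forall v, j1 v = (v, 0), forall s, j2 s = (0, s),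
      forall x, q1 x = x.1 & forall x, q2 x = x.2].
Proof.
have lin1 : linear (fun v : V => (v, 0 : S)).
  by move=> k u v; congr pair; rewrite /= scaler0 addr0.
have lin2 : linear (fun s : S => (0 : V, s)).
  by move=> k u v; congr pair; rewrite /= scaler0 addr0.
have lin3 : linear (fun s : V * S => s.1) by [].
have lin4 : linear (fun s : V * S => s.2) by [].
exists (hom_of_linear lin1), (hom_of_linear lin2), (hom_of_linear lin3),
  (hom_of_linear lin4).
have j1E v : hom_of_linear lin1 v = (v, 0) by rewrite hom_of_linearE.
have j2E s : hom_of_linear lin2 s = (0, s) by rewrite hom_of_linearE.
have q1E x : hom_of_linear lin3 x = x.1 by rewrite hom_of_linearE.
have q2E x : hom_of_linear lin4 x = x.2 by rewrite hom_of_linearE.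
split; split=> //.
- by apply/homAP => x a; rewrite !j1E /= ract0l.
- by apply/homAP => x a; rewrite !j2E /= ract0l.
- by apply/homAP => x a; rewrite !q1E.
- by apply/homAP => x a; rewrite !q2E.
Qed.

Lemma iter_dsum_maps n V Z : exists
    (i : 'I_n -> 'Hom(V, \big[@dsum K A/Z]_(k < n) V))
    (p : 'I_n -> 'Hom(\big[@dsum K A/Z]_(k < n) V, V))
    (z : 'Hom(Z, \big[@dsum K A/Z]_(k < n) V))
    (r : 'Hom(\big[@dsum K A/Z]_(k < n) V, Z)),
  [/\ forall k, i k \in homA V _, forall k, p k \in homA _ V,
      z \in homA Z _ & r \in homA _ Z] /\
  [/\ forall k l, (p k \o i l)%VF = if k == l then \1%VF else 0
    & (\sum_k (i k \o p k) + (z \o r))%VF = \1%VF].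
Proof.
elim: n => [|n [i [p [z [r [[hi hp hz hr] [hpi hs]]]]]]].
  rewrite big_ord0; exists (fun _ => 0), (fun _ => 0), \1%VF, \1%VF; split.
    by split=> *; rewrite ?mem0v ?homA_id.
  by split=> [[]//|]; rewrite big_ord0 add0r comp_lfun1l.
rewrite big_ord_recl; set S := \big[_/_]_(k < n) V in i p z r hi hp hz hr hpi
  hs *.
have [j1 [j2 [q1 [q2 [[hj1 hj2 hq1 hq2] [j1E j2E q1E q2E]]]]]] := dsum_maps V S.
exists (fun k => if unlift ord0 k is Some k' then (j2 \o i k')%VF else j1).
exists (fun k => if unlift ord0 k is Some k' then (p k' \o q2)%VF else q1).
exists (j2 \o z)%VF, (r \o q2)%VF; split; split.
- by move=> k; case: unliftP => [k'|] _ //; apply: homA_comp.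
- by move=> k; case: unliftP => [k'|] _ //; apply: homA_comp.
- exact: homA_comp.
- exact: homA_comp.
- move=> k l; case: (unliftP ord0 k) => [k'|] ->;
    case: (unliftP ord0 l) => [l'|] ->.
  + rewrite (inj_eq lift_inj) -hpi; apply/lfunP => x.
    by rewrite !comp_lfunE j2E q2E.
  + rewrite eq_sym (negPf (neq_lift _ _)); apply/lfunP => x.
    by rewrite !comp_lfunE j1E q2E /= linear0 zero_lfunE.
  + rewrite (negPf (neq_lift _ _)); apply/lfunP => x.
    by rewrite !comp_lfunE j2E q1E zero_lfunE.
  + by rewrite eqxx; apply/lfunP => x; rewrite comp_lfunE j1E q1E id_lfunE.
- rewrite big_ord_recl unlift_none /=.
  under eq_bigr => k _ do rewrite liftK.
  apply/lfunP => x; rewrite !add_lfunE sum_lfunE id_lfunE comp_lfunE j1E q1E.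
  under eq_bigr => k _ do rewrite !comp_lfunE q2E -(comp_lfunE (i k)).
  rewrite -(linear_sum j2) -sum_lfunE !comp_lfunE q2E -addrA -(linearD j2) /=.
  rewrite -(comp_lfunE z) -add_lfunE hs id_lfunE j2E.
  by case: x => a b; congr pair; rewrite /= ?addr0 ?add0r.
Qed.

Lemma biproduct_exists n V : exists S i p, @biproduct n V S i p.
Proof.
have h0 : submodule (0%VS : {vspace V}).
  by move=> x a; rewrite !memv0 => /eqP ->; rewrite ract0l.
(* The zero submodule supplies a tail that is provably zero, in place of [zeromod]. *)
have [Z [i [_ i0 iI]]] := submodule_image h0.
have z0 (z : Z) : z = 0.
  apply: (lker0_inj i0); rewrite linear0; apply/eqP.
  by rewrite -memv0 -iI limg_memv.
have [j [p [z [r [[hj hp hz hr] [hpi hs]]]]]] := iter_dsum_maps n V Z.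
exists (\big[@dsum K A/Z]_(k < n) V), j, p; split=> //.
rewrite -hs -[LHS]addr0; congr (_ + _); apply/lfunP => x.
by rewrite comp_lfunE [r x]z0 linear0 zero_lfunE.
Qed.

(** The complement is the kernel of [p], reached by the projection $1 - ip$. *)
Lemma retract_summand N M (i : 'Hom(N, M)) (p : 'Hom(M, N)) :
  i \in homA N M -> p \in homA M N -> (p \o i)%VF = \1%VF -> summand N M.
Proof.
move=> hi hp hpi; have [L [j [hj j0 jI]]] :=
  submodule_image (lker_submodule hp).
have piE x : p (i x) = x by rewrite -comp_lfunE hpi id_lfunE.
have hf : (\1 - (i \o p))%VF \in homA M M.
  by rewrite memvB ?homA_id // homA_comp.
have fE x : (\1 - (i \o p))%VF x = x - i (p x).
  by rewrite add_lfunE opp_lfunE id_lfunE comp_lfunE.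
have fI : (limg (\1 - (i \o p))%VF <= limg j)%VS.
  apply/subvP => _ /memv_imgP[x _ ->].
  by rewrite jI memv_ker fE linearB /= piE subrr.
have [r hr rE] := hom_corestrict hj j0 hf fI.
have jr x : j (r x) = x - i (p x) by rewrite -fE -rE comp_lfunE.
have [j1 [j2 [q1 [q2 [[hj1 hj2 hq1 hq2] [j1E j2E q1E q2E]]]]]] := dsum_maps N L.
have gE x : ((j1 \o p) + (j2 \o r))%VF x = (p x, r x).
  by rewrite add_lfunE !comp_lfunE j1E j2E; congr pair;
    rewrite /= ?addr0 ?add0r.
exists L, ((j1 \o p) + (j2 \o r))%VF; split.
- by rewrite memvD // homA_comp.
- apply: inj_lker0 => x y; rewrite !gE => -[e1 e2].
  by rewrite -[x](subrK (i (p x))) -jr e1 e2 jr subrK.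
- apply: limg_fullP => -[u v]; exists (i u + j v); rewrite gE.
  have pj : p (j v) = 0 by apply/eqP; rewrite -memv_ker -jI limg_memv.
  have -> : p (i u + j v) = u by rewrite linearD /= piE pj addr0.
  congr pair; apply: (lker0_inj j0).
  by rewrite jr linearD /= piE pj addr0 addrC addKr.
Qed.

Lemma iso_retract N M L : iso M (dsum N L) ->
  exists (i : 'Hom(N, M)) (p : 'Hom(M, N)),
    [/\ i \in homA N M, p \in homA M N & (p \o i)%VF = \1%VF].
Proof.
case=> f [hf f0 fI].
have [j1 [j2 [q1 [q2 [[hj1 hj2 hq1 hq2] [j1E j2E q1E q2E]]]]]] := dsum_maps N L.
have [|i hi iE] := hom_corestrict hf f0 hj1; first by rewrite fI subvf.
exists i, (q1 \o f)%VF; split=> //; first exact: homA_comp.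
by rewrite -comp_lfunA iE; apply/lfunP => x;
  rewrite comp_lfunE j1E q1E id_lfunE.
Qed.

Section Family.
Variables (n : nat) (V S : rmod A) (i : 'I_n -> 'Hom(V, S)) (p : 'I_n ->
  'Hom(S, V)).
Hypothesis hS : biproduct i p.

Lemma biproduct_id x : x = \sum_k i k (p k x).
Proof.
case: hS => _ _ _ hs; rewrite -[LHS](id_lfunE x) -hs sum_lfunE.
by apply: eq_bigr => k _; rewrite comp_lfunE.
Qed.

Lemma biproduct_pi k l x : p k (i l x) = if k == l then x else 0.
Proof.
case: hS => _ _ hpi _; rewrite -comp_lfunE hpi.
by case: (k == l); rewrite lfunE.
Qed.

Lemma biproduct_out X (f : 'I_n -> 'Hom(V, X)) : (forall k, f k \in homA V X) ->
  exists g, [/\ g \in homA S X, g = (\sum_k (f k \o p k))%VF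
             & forall k, (g \o i k)%VF = f k].
Proof.
move=> hf; exists (\sum_k (f k \o p k))%VF; case: (hS) => hi hp _ _; split=> //.
  by apply: memv_suml => k _; apply: homA_comp.
move=> k; apply/lfunP => x; rewrite comp_lfunE sum_lfunE (bigD1 k) //=.
rewrite comp_lfunE biproduct_pi eqxx big1 ?addr0 // => l /negPf hl.
by rewrite comp_lfunE biproduct_pi hl linear0.
Qed.

End Family.

(** A basis of [H] gives the components of $V^n \to X$, and the coordinates of $h$ in that basis
    give its factorization. With [H] the full Hom space this is a right
    $\mathsf{add}\,V$-approximation. *)
Lemma universal_hom V X (H : {vspace 'Hom(V, X)}) : (H <= homA V X)%VS ->
  exists n S (i : 'I_n -> 'Hom(V, S)) (p : 'I_n -> 'Hom(S, V)) (g : 'Hom(S, X)),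
  [/\ biproduct i p, g \in homA S X, forall k, (g \o i k)%VF \in H
    & forall h, h \in H -> exists2 h', h' \in homA V S & (g \o h')%VF = h].
Proof.
move=> /subvP HA; pose b := vbasis H;
  have [S [i [p hS]]] := biproduct_exists (\dim H) V.
have bH (k : 'I_(\dim H)) : b`_k \in H by apply/vbasis_mem/mem_nth;
  rewrite size_tuple.
have [g [hg _ gi]] := biproduct_out hS (fun k : 'I_(\dim H) => HA _ (bH k)).
exists (\dim H), S, i, p, g; split=> // [k|h hh]; first by rewrite gi.
have [hi _ _ _] := hS.
exists (\sum_k coord b k h *: i k).
  by apply: memv_suml => k _; apply: memvZ.
apply/lfunP => x; rewrite [in RHS](coord_vbasis hh) comp_lfunE !sum_lfunE.
by rewrite linear_sum; apply: eq_bigr => k _;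
  rewrite !scale_lfunE linearZ /= -gi comp_lfunE.
Qed.

End Modules.

(** * The Auslander-Reiten translation in terms of projective presentations *)

Section Tau.
Variables (K : fieldType) (A : fdalg K).
Implicit Types X Y Z V S M N P : rmod A.

Definition orbit_map X (x : X) : 'Hom(regmod A, X) :=
  hom_of_linear (@ract_linearr K A X x : linear (ract x : regmod A -> X)).

Lemma orbit_mapE X (x : X) (a : A) : orbit_map x a = ract x a.
Proof. exact: hom_of_linearE. Qed.

Lemma orbit_map_hom X (x : X) : orbit_map x \in homA (regmod A) X.
Proof. by apply/homAP => b a; rewrite !orbit_mapE -ractM. Qed.

(** A free module maps onto $P$ by sending its generators to a basis of $P$. A splitting of this map
    has the [psi k] as components. *)
Lemma dual_basis P : projective P ->
  exists n (x : 'I_n -> P) (psi : 'I_n -> 'Hom(P, regmod A)),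
    (forall k, psi k \in homA P (regmod A)) /\
    forall y, y = \sum_k ract (x k) (psi k y).
Proof.
move=> hP; pose n := \dim (fullv : {vspace P}).
have [S [i [p hS]]] := biproduct_exists n (regmod A).
have [hi hp _ _] := hS.
pose x (k : 'I_n) : P := (vbasis (fullv : {vspace P}))`_k.
have [g [hg gE gi]] := biproduct_out hS (fun k => orbit_map_hom (x k)).
have gfull : limg g = fullv.
  apply: limg_fullP => y.
  exists (\sum_k coord (vbasis (fullv : {vspace P})) k y *: i k (1 : A)).
  rewrite linear_sum [LHS](coord_vbasis (memvf y)); apply: eq_bigr => k _ /=.
  by rewrite linearZ /= -(comp_lfunE g) gi orbit_mapE ract1.
have [h hh hE] := hP _ _ g \1%VF hg gfull (homA_id P).
exists n, x, (fun k => (p k \o h)%VF); split=> [k|y]; first exact: homA_comp.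
rewrite -[LHS](id_lfunE y) -hE gE comp_lfunE sum_lfunE; apply: eq_bigr => k _.
by rewrite !comp_lfunE orbit_mapE.
Qed.

(** Surjectivity of $\mathrm{Hom}_A(f, X)$. When $f$ is a minimal projective presentation of $V$,
    this is equivalent to $\mathrm{Hom}_A(X, \tau V) = 0$. *)
Definition extends P1 P0 (f : 'Hom(P1, P0)) X :=
  forall g, g \in homA P1 X -> exists2 g', g' \in homA P0 X & (g' \o f)%VF = g.

Lemma starmod_actE P (phi : starmod P) (a : opalg A) y :
  vsval (ract phi a : starmod P) y = (a : A) * (vsval phi y : A).
Proof. by rewrite /= comp_lfunE lfunE. Qed.

Lemma starmod_dual_basis P n (x : 'I_n -> P) (psi : 'I_n -> starmod P) :
  (forall y, y = \sum_k ract (x k) (vsval (psi k) y)) ->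
  forall phi : starmod P, phi = \sum_k ract (psi k) (vsval phi (x k) : opalg A).
Proof.
move=> hx phi; apply/val_inj/lfunP => y.
have hphi := homAP _ (subvsP (phi : subvs_of (homA P (regmod A)))).
rewrite [in LHS](hx y) linear_sum /= (linear_sum (vsval : starmod P -> _))
  sum_lfunE.
apply: eq_bigr => k _; rewrite -[RHS]/(vsval (ract (psi k) (vsval phi (x k) :
  opalg A) : starmod P) y).
by rewrite starmod_actE; apply: hphi.
Qed.

Section DualTranspose.
Variables (P1 P0 : rmod A) (f : 'Hom(P1, P0)) (T : rmod (opalg A)).
Variable q : 'Hom(starmod P1, T).
Hypotheses (hP1 : projective P1) (hP0 : projective P0) (hf : f \in homA P1 P0).
Hypotheses (hq : q \in homA (starmod P1) T) (qI : limg q = fullv).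
Hypothesis qK : lker q = limg (starmap f).

Let star_homP P (phi : starmod P) : vsval phi \in homA P (regmod A).
Proof. exact: (subvsP (phi : subvs_of (homA P (regmod A)))). Qed.

(* For T = Tr V, D Hom_A(f, X) has kernel Hom_A(X, D T): a functional l on    *)
(* Hom_A(P1, X) vanishing on the maps that factor through f yields the map    *)
(* sending x to the functional phi |-> l (y |-> x phi(y)) on Hom_A(P1, A).    *)
Lemma perpl_dual_extends X : perpl (dualmod T) X -> extends f X.
Proof.
move=> hX g hg.
pose I := (hom_of_linear (@precomp_linear K P1 P0 X f) @: homA P0 X)%VS.
suff : g \in I.
  by case/memv_imgP => g' hg' ->; exists g' => //; rewrite hom_of_linearE.
apply: memv_functionals => l lI.
have lf h : h \in homA P0 X -> l (h \o f)%VF = 0.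
  by move=> hh; apply: lI; apply/memv_imgP; exists h => //;
    rewrite hom_of_linearE.
pose ev (x : X) (phi : starmod P1) : K^o := l (orbit_map x \o vsval phi)%VF.
have evl x : linear (ev x).
  move=> k u v; rewrite /ev -linearP /=; congr (l _).
  by rewrite comp_lfunDr -comp_lfunZr.
have orbl k x y : orbit_map (k *: x + y) = k *: orbit_map x + orbit_map y :>
  'Hom(regmod A, X).
  by apply/lfunP => a; rewrite add_lfunE scale_lfunE !orbit_mapE ract_linearl.
pose th (x : X) : dualmod T := (hom_of_linear (evl x) \o q^-1)%VF.
have thE x t : (th x : 'Hom(T, K^o)) t = ev x (q^-1%VF t).
  by rewrite /th comp_lfunE hom_of_linearE.
(* Hence [ev x] descends to [T], and [th x] does not depend on the chosen preimage under [q]. *)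
have ev_ker x phi : phi \in lker q -> ev x phi = 0.
  rewrite qK => /memv_imgP[chi _ ->]; rewrite /ev starmapE // comp_lfunA lf //.
  by apply: (@homA_comp K A P0 (regmod A) X);
    [apply: star_homP | apply: orbit_map_hom].
have ev_q x phi phi' : q phi = q phi' -> ev x phi = ev x phi'.
  move=> e; apply/eqP; rewrite -subr_eq0.
  have -> : ev x phi - ev x phi' = ev x (phi - phi').
    by rewrite -!(hom_of_linearE (evl x)) linearB.
  by rewrite ev_ker // memv_ker linearB /= e subrr.
have qKV t : q (q^-1%VF t) = t by rewrite limg_lfunVK // qI memvf.
have thl : linear th.
  move=> k x y; apply/lfunP => t; rewrite add_lfunE scale_lfunE !thE /ev.
  rewrite -linearP; congr (l _).
  by rewrite orbl comp_lfunDl -comp_lfunZl.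
have hth : hom_of_linear thl \in homA X (dualmod T).
  apply/homAP => x a; rewrite !hom_of_linearE; apply/lfunP => t.
  rewrite thE /= comp_lfunE ractfE thE.
  transitivity (ev x (ract (q^-1%VF t) (a : opalg A))).
    rewrite /ev; congr (l _); apply/lfunP => y;
      rewrite !comp_lfunE !orbit_mapE -ractM.
    by congr ract; rewrite lfunE.
  apply: ev_q; rewrite qKV; have hqa := homAP _ hq.
  by rewrite [LHS]hqa qKV.
have th0 := (homA0P _ _).1 hX _ hth.
have ev0 x phi : ev x phi = 0.
  rewrite (@ev_q x phi (q^-1%VF (q phi))) ?qKV // -thE.
  by rewrite -(hom_of_linearE thl) th0 !zero_lfunE.
have [n [x [psi [hpsi hx]]]] := dual_basis hP1.
(* The dual basis writes [g] as a sum of maps $P_1 \to A \to X$, and on each of these [l] is a value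
   of [ev]. *)
have -> : g = \sum_k (orbit_map (g (x k)) \o psi k)%VF.
  apply/lfunP => y; rewrite [in LHS](hx y) linear_sum sum_lfunE /=;
    apply: eq_bigr => k _.
  by rewrite comp_lfunE orbit_mapE; move/homAP: hg => ->.
rewrite linear_sum big1 // => k _ /=.
exact: (ev0 (g (x k)) (Subvs (hpsi k))).
Qed.

(** A map [th] from $X$ to $DT$ yields a functional [mu] on $\mathrm{Hom}_A(P_1, X)$ that kills
    whatever factors through [f]. If every map does, then [mu] vanishes, and with it [th]. *)
Lemma extends_perpl_dual X : extends f X -> perpl (dualmod T) X.
Proof.
move=> hX; apply/homA0P => th /homAP hth; apply/lfunP => x; apply/lfunP => t.
rewrite !zero_lfunE; have [phi ->] := limg_full_ex t qI.
have dualE y (a : A) s : (th (ract y a) : 'Hom(T, K^o)) s =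
    (th y : 'Hom(T, K^o)) (ract s (a : opalg A)).
  by rewrite hth /= comp_lfunE ractfE.
have [n [p [psi' [hpsi hp]]]] := dual_basis hP1.
pose psi k : starmod P1 := Subvs (hpsi k).
(* This inverts the passage from functionals to maps $X \to DT$; [muE] recovers [th] from [mu]. *)
pose mu (g : 'Hom(P1, X)) := \sum_k (th (g (p k)) : 'Hom(T, K^o)) (q (psi k)).
have muE y (chi : starmod P1) :
    mu (orbit_map y \o vsval chi)%VF = (th y : 'Hom(T, K^o)) (q chi).
  rewrite [in RHS](@starmod_dual_basis P1 n p psi hp chi) !linear_sum.
  apply: eq_bigr => k _ /=; rewrite comp_lfunE orbit_mapE dualE.
  congr ((th y : 'Hom(T, K^o)) _).
  exact: (esym (homAP _ hq (psi k) (vsval chi (p k) : opalg A))).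
rewrite -muE.
have hg : (orbit_map x \o vsval phi)%VF \in homA P1 X.
  by apply: (@homA_comp K A P1 (regmod A) X);
    [apply: star_homP | apply: orbit_map_hom].
have [g' hg' <-] := hX _ hg.
have [m [r [chi [hchi hr]]]] := dual_basis hP0.
(* A dual basis of [P0] splits [g'], so each summand involves an element of the image of
   [starmap f], which [q] kills. *)
have -> : (g' \o f)%VF = \sum_j (orbit_map (g' (r j)) \o
    vsval (starmap f (Subvs (hchi j) : starmod P0)))%VF.
  apply/lfunP => y; rewrite sum_lfunE comp_lfunE [in LHS](hr (f y)) linear_sum.
  apply: eq_bigr => j _ /=; rewrite comp_lfunE orbit_mapE starmapE //
    comp_lfunE.
  by move/homAP: hg' => ->.
have mu_sum k (G : 'I_k -> 'Hom(P1, X)) : mu (\sum_j G j) = \sum_j mu (G j).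
  rewrite /mu exchange_big; apply: eq_bigr => i _ /=.
  by rewrite sum_lfunE linear_sum /= sum_lfunE.
rewrite mu_sum big1 // => j _; rewrite muE.
suff -> : q (starmap f (Subvs (hchi j) : starmod P0)) = 0 by rewrite linear0.
by apply/eqP; rewrite -memv_ker qK limg_memv.
Qed.

End DualTranspose.

Lemma iso_perpl N N' X : iso N N' -> perpl N X <-> perpl N' X.
Proof.
case=> j [hj j0 jI]; split=> /homA0P h; apply/homA0P => th hth.
  have [|th' hth' <-] := hom_corestrict hj j0 hth; first by rewrite jI subvf.
  by rewrite (h _ hth') comp_lfun0r.
have := h _ (homA_comp hth hj); move/lfunP => e; apply/lfunP => x.
by apply: (lker0_inj j0); have := e x; rewrite comp_lfunE !zero_lfunE linear0.
Qed.

Lemma tau_presentation V N : is_tau V N ->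
  exists (P1 P0 : rmod A) (f : 'Hom(P1, P0)) (p : 'Hom(P0, V)),
  [/\ projective P0, f \in homA P1 P0, p \in homA P0 V & limg p = fullv] /\
  limg f = lker p /\ forall X, perpl N X <-> extends f X.
Proof.
case=> T [P1 [P0 [f [p [[[hP0 hp pI _] [hP1 hf fI _]] [q [hq qI qK]]]]]]] hN.
exists P1, P0, f, p; split=> //; split=> // X; rewrite (iso_perpl X hN).
by split; [apply: (perpl_dual_extends (q :=
  q)) | apply: (extends_perpl_dual (q := q))].
Qed.

End Tau.

(** * Lifting along maps with a given kernel, and modules generated by [M] *)

Section Generation.
Variables (K : fieldType) (A : fdalg K).
Implicit Types X Y Z V S M N P C U Q I T : rmod A.

Definition kernel_of S Y Z (k : 'Hom(S, Y)) (g : 'Hom(Y, Z)) :=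
  [/\ k \in homA S Y, lker k = 0%VS & limg k = lker g].

Lemma kernel_exists Y Z (g : 'Hom(Y, Z)) : g \in homA Y Z ->
  exists S (k : 'Hom(S, Y)), kernel_of k g.
Proof. by move=> hg; apply: (submodule_image (lker_submodule hg)). Qed.

Lemma kernel_comp0 S Y Z (k : 'Hom(S, Y)) (g : 'Hom(Y, Z)) x :
  kernel_of k g -> g (k x) = 0.
Proof. by case=> _ _ kI; apply/eqP; rewrite -memv_ker -kI limg_memv. Qed.

Lemma kernel_lift S Y Z V (k : 'Hom(S, Y)) (g : 'Hom(Y, Z)) (h : 'Hom(V, Y)) :
  kernel_of k g -> h \in homA V Y -> (forall x, g (h x) = 0) ->
  exists2 h', h' \in homA V S & (k \o h')%VF = h.
Proof.
case=> hk k0 kI hh gh; apply: (hom_corestrict hk k0 hh).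
by apply/subvP => _ /memv_imgP[x _ ->]; rewrite kI memv_ker gh.
Qed.

Lemma image_factor Y Z (g : 'Hom(Y, Z)) : g \in homA Y Z ->
  exists I (j : 'Hom(I, Z)) (g0 : 'Hom(Y, I)),
  [/\ j \in homA I Z, lker j = 0%VS, g0 \in homA Y I, limg g0 = fullv
    & (j \o g0)%VF = g /\ limg j = limg g].
Proof.
move=> hg; have [I [j [hj j0 jI]]] := submodule_image (limg_submodule hg).
have [|g0 hg0 gE] := hom_corestrict hj j0 hg; first by rewrite jI.
exists I, j, g0; split=> //; apply: limg_fullP => y.
have /memv_imgP[x _ e] : j y \in limg g by rewrite -jI limg_memv.
by exists x; apply: (lker0_inj j0); rewrite e -gE comp_lfunE.
Qed.

(** Lift [h] composed with [p] to $v : P_0 \to Y$. Then $vf$ lands in the kernel $S$ and extends to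
    $u' : P_0 \to S$; the corrected lift $v - ku'$ kills $\ker p$ and descends to $V$. *)
Lemma extends_lift V P1 P0 (f : 'Hom(P1, P0)) (p : 'Hom(P0, V))
    S Y Z (k : 'Hom(S, Y)) (g : 'Hom(Y, Z)) (h : 'Hom(V, Z)) :
  projective P0 -> f \in homA P1 P0 -> p \in homA P0 V -> limg p = fullv ->
  limg f = lker p -> extends f S ->
  kernel_of k g -> g \in homA Y Z -> h \in homA V Z -> (limg h <= limg g)%VS ->
  exists2 h', h' \in homA V Y & (g \o h')%VF = h.
Proof.
move=> hP0 hf hp pI fI hext hkg hg hh hsub; have [hk k0 kI] := hkg.
have [I [j [g0 [hj j0 hg0 g0I [gE jI]]]]] := image_factor hg.
have [|h0 hh0 h0E] := hom_corestrict hj j0 hh; first by rewrite jI.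
have [v hv vE] := hP0 _ _ g0 _ hg0 g0I (homA_comp hp hh0).
have gv x : g (v x) = h (p x).
  by rewrite -gE -h0E !comp_lfunE -(comp_lfunE g0) vE comp_lfunE.
have pf x : p (f x) = 0 by apply/eqP; rewrite -memv_ker -fI limg_memv.
have [x|u hu uE] := kernel_lift hkg (homA_comp hf hv).
  by rewrite comp_lfunE gv pf linear0.
have [u' hu' u'E] := hext _ hu.
have hw : (v - (k \o u'))%VF \in homA P0 Y by rewrite memvB // homA_comp.
have [|h' hh' h'E] := hom_factor hp pI hw.
  apply/subvP => y; rewrite -fI => /memv_imgP[x _ ->].
  rewrite memv_ker add_lfunE opp_lfunE comp_lfunE -(comp_lfunE u') u'E.
  by rewrite -(comp_lfunE k) uE comp_lfunE subrr.
exists h' => //; apply/lfunP => y; have [x ->] := limg_full_ex y pI.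
rewrite comp_lfunE -(comp_lfunE h') h'E add_lfunE opp_lfunE comp_lfunE.
by rewrite linearB /= gv (kernel_comp0 _ hkg) subr0.
Qed.

(** Extend $ku$ to $v : P_0 \to Y$. Then $gv$ descends to a map $V \to Z$ with image in that of $g$;
    subtracting a lift of it from $v$ gives a map into $S$ that still extends $u$. *)
Lemma extends_kernel V P1 P0 (f : 'Hom(P1, P0)) (p : 'Hom(P0, V))
    S Y Z (k : 'Hom(S, Y)) (g : 'Hom(Y, Z)) :
  f \in homA P1 P0 -> p \in homA P0 V -> limg p = fullv ->
  limg f = lker p -> extends f Y -> kernel_of k g -> g \in homA Y Z ->
  (forall h, h \in homA V Z -> (limg h <= limg g)%VS ->
    exists2 h', h' \in homA V Y & (g \o h')%VF = h) ->
  extends f S.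
Proof.
move=> hf hp pI fI hext hkg hg hlift u hu; have [hk k0 kI] := hkg.
have [v hv vE] := hext _ (homA_comp hu hk).
have vf x : v (f x) = k (u x) by rewrite -comp_lfunE vE comp_lfunE.
have [|h hh hE] := hom_factor hp pI (homA_comp hv hg).
  apply/subvP => y; rewrite -fI => /memv_imgP[x _ ->].
  by rewrite memv_ker comp_lfunE vf (kernel_comp0 _ hkg).
have hpE x : h (p x) = g (v x) by rewrite -comp_lfunE hE comp_lfunE.
have [|h' hh' h'E] := hlift h hh.
  apply/subvP => _ /memv_imgP[y _ ->]; have [x ->] := limg_full_ex y pI.
  by rewrite hpE limg_memv.
have hw : (v - (h' \o p))%VF \in homA P0 Y by rewrite memvB // homA_comp.
have wE x : (v - (h' \o p))%VF x = v x - h' (p x).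
  by rewrite add_lfunE opp_lfunE comp_lfunE.
have [x|w hw' wk] := kernel_lift hkg hw.
  by rewrite wE linearB /= -(comp_lfunE g h') h'E hpE subrr.
exists w => //; apply/lfunP => x; apply: (lker0_inj k0).
rewrite comp_lfunE -(comp_lfunE k) wk wE vf.
have /eqP -> : p (f x) == 0 by rewrite -memv_ker -fI limg_memv.
by rewrite linear0 subr0.
Qed.

(** The trace of [M] in [X] is all of [X]. This is membership in $\mathsf{Fac}\,M$ without direct
    sums or [zeromod]. *)
Definition gen M X :=
  forall W : {vspace X}, (forall h, h \in homA M X -> (limg h <= W)%VS) ->
    W = fullv.

Lemma gen_self M : gen M M.
Proof.
move=> W /(_ _ (homA_id M)); rewrite lim1g => h.
by apply/eqP; rewrite eqEsubv subvf.
Qed.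

Lemma gen_eq0 M X (V : vectType K) (g : 'Hom(X, V)) : gen M X ->
  (forall h, h \in homA M X -> (g \o h)%VF = 0) -> g = 0.
Proof.
move=> hX hg; have e : lker g = fullv.
  apply: hX => h hh; apply/subvP => _ /memv_imgP[x _ ->].
  by rewrite memv_ker -comp_lfunE (hg _ hh) zero_lfunE.
apply/lfunP => x; rewrite zero_lfunE; apply/eqP.
by rewrite -memv_ker e memvf.
Qed.

Lemma gen_epi M X Y (f : 'Hom(X, Y)) :
  f \in homA X Y -> limg f = fullv -> gen M X -> gen M Y.
Proof.
move=> hf fI hX W hW; have e : (f @^-1: W)%VS = fullv.
  apply: hX => h hh; apply/subvP => _ /memv_imgP[x _ ->].
  rewrite -memv_preim; apply: (subvP (hW _ (homA_comp hh hf))).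
  by rewrite -comp_lfunE limg_memv.
apply/vspaceP => y; rewrite memvf; have [x ->] := limg_full_ex y fI.
by rewrite memv_preim e memvf.
Qed.

Lemma gen_biproduct M n S (i : 'I_n -> 'Hom(M, S)) (p : 'I_n -> 'Hom(S, M)) :
  biproduct i p -> gen M S.
Proof.
move=> hS W hW; apply/vspaceP => x; rewrite memvf (biproduct_id hS x).
case: hS => hi _ _ _; apply: memv_suml => k _.
by apply: (subvP (hW _ (hi k))); apply: limg_memv.
Qed.

Lemma gen_image M X Y (f : 'Hom(X, Y)) S (j : 'Hom(S, Y)) : f \in homA X Y ->
  gen M X -> j \in homA S Y -> lker j = 0%VS -> limg j = limg f -> gen M S.
Proof.
move=> hf hX hj j0 jI; have [|f0 hf0 fE] := hom_corestrict hj j0 hf.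
  by rewrite jI.
apply: (gen_epi hf0) hX; apply: limg_fullP => y.
have /memv_imgP[x _ e] : j y \in limg f by rewrite -jI limg_memv.
by exists x; apply: (lker0_inj j0); rewrite e -fE comp_lfunE.
Qed.

Lemma gen_universal M X n S (i : 'I_n -> 'Hom(M, S)) (p : 'I_n -> 'Hom(S, M))
    (g : 'Hom(S, X)) : gen M X ->
  (forall h, h \in homA M X -> exists2 h', h' \in homA M S & (g \o h')%VF = h)
    ->
  limg g = fullv.
Proof.
move=> hX hg; apply: hX => h /hg[h' _ <-].
by apply/subvP => _ /memv_imgP[x _ ->]; rewrite comp_lfunE limg_memv.
Qed.

Lemma gen_Fac M X : gen M X -> Fac M X.
Proof.
move=> hX; have [n [S [i [p [g [hS hg _ hlift]]]]]] :=
  universal_hom (subvv (homA M X)).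
exists S, g; split=> //; last exact: (gen_universal i p hX hlift).
have [i' [p' [z [r [[hi' hp' _ _] [hpi _]]]]]] :=
  iter_dsum_maps n M (zeromod A).
have [hi hp _ _] := hS.
exists n; apply: (@retract_summand _ _ _ _
    (\sum_k (i' k \o p k))%VF (\sum_k (i k \o p' k))%VF).
- by apply: memv_suml => k _; apply: homA_comp.
- by apply: memv_suml => k _; apply: homA_comp.
apply/lfunP => x; rewrite comp_lfunE id_lfunE !sum_lfunE [RHS](biproduct_id hS).
apply: eq_bigr => k _; rewrite comp_lfunE linear_sum (bigD1 k) //= big1.
  by rewrite addr0 comp_lfunE -(comp_lfunE (p' k)) hpi eqxx id_lfunE.
move=> l /negPf hl; rewrite comp_lfunE -(comp_lfunE (p' k)) hpi eq_sym hl.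
by rewrite zero_lfunE.
Qed.

(** The map [z] accounts for the tail [zeromod] of the iterated sums in [add]. *)
Lemma Fac_cover M C : Fac M C ->
  exists n (i : 'I_n -> 'Hom(M, C)) (z : 'Hom(zeromod A, C)),
  [/\ forall k, i k \in homA M C, z \in homA (zeromod A) C
    & ((\sum_k limg (i k)) + limg z)%VS = fullv].
Proof.
case=> N [f [[n [L hL]] hf fI]].
have [a [b [ha hb ab]]] := iso_retract hL.
have [i [p [z [r [[hi hp hz hr] [_ hs]]]]]] := iter_dsum_maps n M (zeromod A).
exists n, (fun k => (f \o b \o i k)%VF), (f \o b \o z)%VF; split.
- by move=> k; rewrite -comp_lfunA; do 2!apply: homA_comp => //.
- by rewrite -comp_lfunA; do 2!apply: homA_comp => //.
apply/vspaceP => y; rewrite memvf; have [x ->] := limg_full_ex y fI.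
rewrite -[x]id_lfunE -ab comp_lfunE -[a x]id_lfunE -hs add_lfunE sum_lfunE.
have fE V (v : 'Hom(V, _)) u : f (b (v u)) \in limg (f \o b \o v)%VF.
  have -> : f (b (v u)) = (f \o b \o v)%VF u by rewrite !comp_lfunE.
  exact: limg_memv.
rewrite !linearD memv_add //; last by rewrite comp_lfunE fE.
rewrite !linear_sum; apply: memv_suml => k _ /=.
by apply: (subvP (sumv_sup k _ (subvv _))) => //; rewrite comp_lfunE fE.
Qed.

(* [zeromod] does not reduce: its definition goes through an opaque constant. *)
(* It may thus be any module Z, but if Z^n is a factor of some M^m + Z for all*)
(* n then so is Y^n for Y the quotient of Z by the trace of M, and Y^n is     *)
(* already a factor of Z; comparing dimensions, Y = 0.                        *)
Lemma gen_zeromod M :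
  (forall n S i p, @biproduct K A n (zeromod A) S i p -> Fac M S) ->
  gen M (zeromod A).
Proof.
set Z0 := zeromod A => hFac.
have [m [T [i0 [p0 [s [hT hs _ slift]]]]]] := universal_hom (subvv (homA M Z0)).
have [Y [q [hq qI qK]]] := submodule_quotient (limg_submodule hs).
suff Y0 : forall y : Y, y = 0.
  apply: (gen_epi hs _ (gen_biproduct hT)); rewrite -qK.
  by apply/vspaceP => x; rewrite memvf memv_ker; apply/eqP/Y0.
move=> y; apply/eqP/negPn/negP => y0.
(* One more than the dimension of [Z0]: a nonzero [y] gives [n] independent vectors in $Y^n$, too
   many for an image of [Z0]. *)
pose n := (\dim (fullv : {vspace Z0})).+1.
have [S [i [p hS]]] := biproduct_exists n Z0.
have [S' [i' [p' hS']]] := biproduct_exists n Y.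
have [hi hp _ _] := hS; have [hi' hp' _ _] := hS'.
have [l [a [z [ha hz az]]]] := Fac_cover (hFac _ _ _ _ hS).
pose Q : 'Hom(S, S') := (\sum_j (i' j \o q \o p j))%VF.
have Qa k x : Q (a k x) = 0.
  rewrite sum_lfunE big1 // => j _; rewrite !comp_lfunE.
  suff /eqP -> : q (p j (a k x)) == 0 by rewrite linear0.
  rewrite -memv_ker qK; have [h hh hE] := slift _ (homA_comp (ha k) (hp j)).
  by rewrite -comp_lfunE -hE comp_lfunE limg_memv.
have Qfull : limg Q = fullv.
  apply: limg_fullP => x.
  have /fin_all_exists[w hw] j : exists w, p' j x = q w by apply: limg_full_ex.
  exists (\sum_j i j (w j)); rewrite sum_lfunE [LHS](biproduct_id hS').
  apply: eq_bigr => j _; rewrite !comp_lfunE hw linear_sum (bigD1 j) //=.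
  rewrite (biproduct_pi hS) eqxx big1 ?addr0 // => k hk.
  by rewrite (biproduct_pi hS) eq_sym (negPf hk).
have Qz : limg (Q \o z)%VF = fullv.
  rewrite limg_comp -[RHS]Qfull -az limgD limg_sum.
  rewrite [X in (X + _)%VS]big1 ?add0v // => k _.
  by apply/vspaceP => x; apply/memv_imgP/idP => [[_ /memv_imgP[u _ ->] ->]|
    ]; rewrite ?Qa ?mem0v // memv0 => /eqP ->; exists 0;
      rewrite ?mem0v ?linear0.
have fr : free [tuple i' j y | j < n].
  apply/freeP => c hc j; have := congr1 (p' j) hc.
  rewrite linear0 linear_sum (bigD1 j) //= linearZ /= (nth_map j)
    ?size_enum_ord //.
  rewrite nth_ord_enum (biproduct_pi hS') eqxx big1 => [|k hk].
    by rewrite addr0 => /eqP; rewrite scaler_eq0 (negPf y0) orbF => /eqP.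
  rewrite linearZ /= (nth_map j) ?size_enum_ord // nth_ord_enum.
  by rewrite (biproduct_pi hS') eq_sym (negPf hk) scaler0.
have := dimvS (subvf <<[tuple i' j y | j < n]>>%VS).
rewrite (eqP fr) size_tuple leqNgt ltnS -Qz => /negP; apply.
by rewrite -(limg_ker_dim (Q \o z) fullv) leq_addl.
Qed.

Lemma Fac_gen M C : gen M (zeromod A) -> Fac M C -> gen M C.
Proof.
move=> hZ /Fac_cover[n [i [z [hi hz iz]]]] W hW.
apply/eqP; rewrite eqEsubv subvf -iz subv_add /=; apply/andP; split.
  by apply/subv_sumP => k _; apply: hW.
apply/subvP => _ /memv_imgP[x _ ->].
have : x \in (z @^-1: W)%VS.
  rewrite (hZ (z @^-1: W)%VS) ?memvf // => h hh.
  apply/subvP => _ /memv_imgP[u _ ->]; rewrite -memv_preim.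
  by apply: (subvP (hW _ (homA_comp hh hz))); rewrite -comp_lfunE limg_memv.
by rewrite -memv_preim.
Qed.

End Generation.

(** * Torsion radicals, and chains of torsion classes with repetitions *)

Section TorsionClasses.
Variables (K : fieldType) (A : fdalg K).
Implicit Types (X Y Z V S : rmod A) (T : subcat A).

(** Induction on dimension: if a nonzero map from a module of [T] hits $X$, divide by its image. The
    preimage of the radical of the quotient is an extension of two modules of [T]. *)
Lemma torsion_radical T X : torsion_class T ->
  exists S Y (i : 'Hom(S, X)) (q : 'Hom(X, Y)),
  [/\ T S, kernel_of i q, q \in homA X Y, limg q = fullv
    & forall Z f, T Z -> f \in homA Z Y -> f = 0].
Proof.
case=> T0 Tq Te; move: {2}(\dim _).+1 (ltnSn (\dim (fullv : {vspace X}))) => n.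
elim: n X => // n IH X; rewrite ltnS => hn.
case: (classic (forall Z f, T Z -> f \in homA Z X -> f = 0)) => [h|].
  have [S [k hk]] := kernel_exists (homA_id X).
  exists S, X, k, \1%VF; split=> //; rewrite ?homA_id ?lim1g //.
  apply: T0; apply/is_zeroP => z; case: (hk) => _ k0 _; apply: (lker0_inj k0).
  by rewrite linear0 -[LHS]id_lfunE (kernel_comp0 _ hk).
move=> h; have [Z {}h] := not_all_ex_not _ _ h;
  have [f {}h] := not_all_ex_not _ _ h.
have [hZ {}h] := imply_to_and _ _ h; have {h} [hf f0] := imply_to_and _ _ h.
have [I [j [f' [hj j0 hf' fI' [_ jI]]]]] := image_factor hf.
have hI : T I := Tq _ _ _ hf' fI' hZ.
have [X1 [q1 [hq1 q1I q1K]]] := submodule_quotient (limg_submodule hf).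
have [|S1 [Y [i1 [q2 [hS1 hi1 hq2 q2I hY]]]]] := IH X1.
  apply: leq_trans hn; rewrite -q1I -(limg_ker_dim q1 fullv) capfv q1K.
  rewrite -[ltnLHS]add0n ltn_add2r lt0n dimv_eq0; apply/eqP => h.
  by apply: f0; apply/lfunP => x; rewrite zero_lfunE; apply/eqP;
    rewrite -memv0 -h limg_memv.
have hq := homA_comp hq1 hq2; have [S [k hk]] := kernel_exists hq.
have [hkh k0 kI] := hk; have [hi1h i10 i1I] := hi1.
exists S, Y, k, (q2 \o q1)%VF; split=> //; last by rewrite limg_comp q1I.
have jq y : q1 (j y) = 0 by apply/eqP; rewrite -memv_ker q1K -jI limg_memv.
have [y|a ha aE] := kernel_lift hk hj; first by rewrite comp_lfunE jq linear0.
have [y|b hb bE] := kernel_lift hi1 (homA_comp hkh hq1).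
  by rewrite comp_lfunE -(comp_lfunE q2 q1) (kernel_comp0 _ hk).
have kE y : k (a y) = j y by rewrite -aE comp_lfunE.
have i1E y : i1 (b y) = q1 (k y) by rewrite -(comp_lfunE i1) bE comp_lfunE.
apply: (Te I S S1 a b) => //.
- by apply: inj_lker0 => x y exy; apply: (lker0_inj j0); rewrite -!kE exy.
- apply/vspaceP => w; rewrite memv_ker; apply/idP/eqP => [/memv_imgP[y _ ->]|h].
    by apply: (lker0_inj i10); rewrite i1E kE jq linear0.
  have : k w \in limg j by rewrite jI -q1K memv_ker -i1E h linear0.
  case/memv_imgP => y _ e; have -> : w = a y by apply: (lker0_inj k0);
    rewrite kE.
  exact: limg_memv.
- apply: limg_fullP => y; have [x xE] := limg_full_ex (i1 y) q1I.
  have : x \in limg k.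
    by rewrite kI memv_ker comp_lfunE -xE (kernel_comp0 _ hi1).
  by case/memv_imgP => w _ e; exists w; apply: (lker0_inj i10); rewrite i1E -e.
Qed.

Lemma torsion_perpl T X : torsion_class T ->
  torsion_class (fun Y => T Y /\ perpl X Y).
Proof.
case=> T0 Tq Te; split.
- move=> Y hY; split; first exact: T0.
  apply/homA0P => f _; apply/lfunP => y.
  by rewrite ((is_zeroP Y).1 hY y) linear0 zero_lfunE.
- move=> Y Z f hf fI [hY /homA0P hYX]; split; first exact: Tq fI hY.
  apply/homA0P => g hg; apply/lfunP => z; have [y ->] := limg_full_ex z fI.
  by rewrite -comp_lfunE (hYX _ (homA_comp hf hg)) !zero_lfunE.
- move=> Y1 Y Y2 f g hf hg f0 fg gI [h1 /homA0P h1X] [h2 /homA0P h2X].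
  split; first exact: (Te _ _ _ f g).
  apply/homA0P => t ht; have [|s hs <-] := hom_factor hg gI ht.
    rewrite -fg; apply/subvP => _ /memv_imgP[y _ ->].
    by rewrite memv_ker -comp_lfunE (h1X _ (homA_comp hf ht)) zero_lfunE.
  by rewrite (h2X _ hs) comp_lfun0l.
Qed.

(** An equality step is skipped and a covering step is appended. Subcategories agree only
    extensionally, so the last cover is transported along [cl]. *)
Lemma weak_maximal_green_sequence (m : nat) (d : nat -> subcat A) :
  subcat_eq (d 0%N) (@is_zero K A) ->
  (forall i, (i <= m)%N -> torsion_class (d i)) ->
  (forall i, (i < m)%N ->
    subcat_eq (d i) (d i.+1) \/ torsion_cover (d i) (d i.+1)) ->
  has_maximal_green_sequence (d m).
Proof.
move=> d0; elim: m => [|m IH] dT dC; first by exists 0%N, d; split.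
have [||l [c [c0 cl cT cC]]] := IH.
- by move=> i hi; apply: dT; apply: leqW.
- by move=> i hi; apply: dC; apply: leqW.
case: (dC m (ltnSn m)) => [e|[[dle dnle] dcov]].
  by exists l, c; split=> // X; rewrite cl; apply: e.
pose c' i := if (i <= l)%N then c i else d m.+1.
exists l.+1, c'; split.
- by rewrite /c'.
- by rewrite /c' ltnn.
- by move=> i _; rewrite /c'; case: ifP => [/cT //|_]; apply: dT.
move=> i; rewrite ltnS /c' => hi; rewrite hi; case: ltnP => [/cC //|hl].
have -> : i = l by apply/eqP; rewrite eqn_leq hi.
split; first split.
- by move=> X /cl; apply: dle.
- by move=> h; apply: dnle => X /h /cl.
case=> S [hS [lS Sl] Sd]; apply: dcov; exists S; split=> //; split.
  by move=> X /cl; apply: lS.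
by move=> h; apply: Sl => X /h /cl.
Qed.

End TorsionClasses.

(** * Jasso's equivalence between $\mathsf{Fac}\,M \cap U^\bot$ and the modules over $B/BeB$ *)

Section Reduction.
Variables (K : fieldType) (A : fdalg K) (U M : rmod A) (e : endalg M).
Variables (iU : 'Hom(U, M)) (pU : 'Hom(M, U)).
Hypotheses (hiU : iU \in homA U M) (hpU : pU \in homA M U).
Hypotheses (pUiU : (pU \o iU)%VF = \1%VF) (eE : vsval e = (iU \o pU)%VF).
(** The trace of $\mathsf{Fac}\,M = {}^\bot(\tau U) \cap Q^\bot$ in this section. *)
Hypothesis gen_kernel : forall Y Z S (k : 'Hom(rmod_sort S, rmod_sort Y))
    (g : 'Hom(rmod_sort Y, rmod_sort Z)),
  gen M Y -> kernel_of k g -> g \in homA Y Z ->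
  (forall h, h \in homA U Z -> (limg h <= limg g)%VS ->
    exists2 h', h' \in homA U Y & (g \o h')%VF = h) ->
  gen M S.
(* Ext^1_A(M, S) = 0 for S in Fac M.                                          *)
Hypothesis gen_lift : forall S Y Z (k : 'Hom(rmod_sort S, rmod_sort Y))
    (g : 'Hom(rmod_sort Y, rmod_sort Z)) (h : 'Hom(M, rmod_sort Z)),
  gen M S -> kernel_of k g -> g \in homA Y Z -> h \in homA M Z ->
  (limg h <= limg g)%VS ->
  exists2 h', h' \in homA M Y & (g \o h')%VF = h.

Implicit Types X Y Z S T V : rmod A.
Local Notation C := (quotalg e).
Implicit Types N : rmod C.

Lemma gen_liftU S Y Z (k : 'Hom(S, Y)) (g : 'Hom(Y, Z)) (h : 'Hom(U, Z)) :
  gen M S -> kernel_of k g -> g \in homA Y Z -> h \in homA U Z ->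
  (limg h <= limg g)%VS ->
  exists2 h', h' \in homA U Y & (g \o h')%VF = h.
Proof.
move=> hS hk hg hh hsub; have [|l hl lE] :=
  gen_lift hS hk hg (homA_comp hpU hh).
  by rewrite limg_comp; apply: subv_trans (limgS _ (subvf _)) hsub.
exists (l \o iU)%VF; first exact: homA_comp.
by rewrite comp_lfunA lE -comp_lfunA pUiU comp_lfun1r.
Qed.

Lemma gen_kernel_perp Y Z S (k : 'Hom(S, Y)) (g : 'Hom(Y, Z)) :
  gen M Y -> perpr U Z -> kernel_of k g -> g \in homA Y Z -> gen M S.
Proof.
move=> hY /homA0P hZ hk hg; apply: (gen_kernel hY hk hg) => h /hZ -> _.
by exists 0; rewrite ?mem0v ?comp_lfun0r.
Qed.

Lemma gen_U : gen M U.
Proof.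
apply: gen_epi hpU _ (@gen_self _ _ M); apply: limg_fullP => u.
by exists (iU u); rewrite -comp_lfunE pUiU id_lfunE.
Qed.

Lemma genU_gen X : gen U X -> gen M X.
Proof.
move=> hX W hW; apply: hX => h hh; apply/subvP => _ /memv_imgP[u _ ->].
rewrite memv_preim; suff -> : (h @^-1: W)%VS = fullv by apply: memvf.
apply: gen_U => g hg; apply/subvP => _ /memv_imgP[x _ ->].
rewrite -memv_preim; apply: (subvP (hW _ (homA_comp hg hh))).
by rewrite -comp_lfunE limg_memv.
Qed.

Lemma idempotent_ideal u v : quotfun e (u * e * v) = 0 :> C.
Proof. by apply/eqP; rewrite quotfun_eq0 mul_ideal_gen. Qed.

(** Elements of $BeB$ are sums of endomorphisms factoring through $U$, and $U$ has no nonzero map to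
    $X$. *)
Lemma ideal_acts0 X (h : 'Hom(M, X)) (b : endalg M) : perpr U X ->
  h \in homA M X -> b \in ideal_gen e -> (h \o vsval b)%VF = 0.
Proof.
move=> /homA0P hX hh /memv_ideal_gen[n [u [v ->]]].
apply/lfunP => x; rewrite zero_lfunE comp_lfunE.
rewrite (linear_sum (vsval : endalg M -> _)) sum_lfunE linear_sum big1 // => k _ /=;
  rewrite !comp_lfunE eE comp_lfunE.
have hk : (h \o vsval (u k) \o iU)%VF \in homA U X.
  by rewrite -comp_lfunA; apply: homA_comp => //; apply: homA_comp => //;
    apply: (subvsP (u k)).
by have /lfunP/(_ (pU (vsval (v k) x))) := hX _ hk;
  rewrite !comp_lfunE zero_lfunE.
Qed.

(* [b] identifies the right C-module N with Hom_A(M, X).                      *)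
Definition corr N X (b : 'Hom(N, 'Hom(M, X))) :=
  [/\ lker b = 0%VS, limg b = homA M X
    & forall x (c : endalg M),
        b (ract x (quotfun e c : C)) = (b x \o vsval c)%VF].

Lemma corr_hom N X (b : 'Hom(N, 'Hom(M, X))) x : corr b -> b x \in homA M X.
Proof. by case=> _ <- _; apply: limg_memv. Qed.

Lemma corr_surj N X (b : 'Hom(N, 'Hom(M, X))) h :
  corr b -> h \in homA M X -> exists x, b x = h.
Proof. by case=> _ <- _ /memv_imgP[x _ ->]; exists x. Qed.

Lemma corr_inj N X (b : 'Hom(N, 'Hom(M, X))) : corr b -> injective b.
Proof. by case=> b0 _ _; apply: lker0_inj. Qed.

Lemma corr_ract N X (b : 'Hom(N, 'Hom(M, X))) x (c : C) :
  corr b -> b (ract x c) = (b x \o vsval (vsval c : endalg M))%VF.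
Proof. by case=> _ _ <-; rewrite [quotfun _ _]quotfunK. Qed.

(** The class of $e$ in $C$ is zero, so composing with $e$ kills every map $M \to X$, in particular
    $t p_U$ for $t : U \to X$. *)
Lemma corr_perp N X (b : 'Hom(N, 'Hom(M, X))) : corr b -> perpr U X.
Proof.
move=> hb; apply/homA0P => t ht; have [x xE] := corr_surj hb (homA_comp hpU ht).
have [_ _ /(_ x e)] := hb.
have -> : quotfun e e = 0 :> C.
  by rewrite -[RHS](idempotent_ideal 1 1) mul1r mulr1.
rewrite (linear0 (ract x)) linear0 xE eE => h0.
have : ((t \o pU) \o (iU \o pU) \o iU)%VF = 0 by rewrite -h0 comp_lfun0l.
by rewrite -!comp_lfunA pUiU comp_lfun1r pUiU comp_lfun1r.
Qed.

Lemma corr_exists X : perpr U X -> exists N (b : 'Hom(N, 'Hom(M, X))), corr b.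
Proof.
move=> hX; pose H := subvs_of (homA M X).
have hact (h : H) (c : C) : (vsval h \o vsval (vsval c : endalg M))%VF \in homA
  M X.
  by apply: homA_comp; apply: subvsP.
pose act (h : H) (c : C) : H := Subvs (hact h c).
(* Any representative of a class acts in the same way, by [ideal_acts0]. *)
have actE (h : H) (c : endalg M) :
    vsval (act h (quotfun e c)) = (vsval h \o vsval c)%VF.
  apply/eqP; rewrite -subr_eq0 /=.
  have hc : vsval (quotfun e c) - c \in ideal_gen e by apply/quotfunP;
    rewrite quotfunK.
  rewrite -(ideal_acts0 hX (subvsP h) hc); apply/eqP/lfunP => x.
  rewrite add_lfunE opp_lfunE !comp_lfunE (linearB (vsval : endalg M -> _)).
  by rewrite !add_lfunE !opp_lfunE !linearB /=.
have h1 (c : C) : linear (act^~ c).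
  by move=> k u v; apply/val_inj; rewrite /= comp_lfunDl -comp_lfunZl.
have h2 (h : H) : linear (act h).
  by move=> k u v; apply/val_inj; rewrite /= comp_lfunDr -comp_lfunZr.
have h3 (h : H) (c d : C) : act h (c * d) = act (act h c) d.
  apply/val_inj; rewrite [LHS]actE /=.
  by rewrite comp_lfunA.
have h4 (h : H) : act h 1 = h.
  by apply/val_inj; rewrite [LHS]actE /= comp_lfun1r.
pose N := @RMod K C H act h1 h2 h3 h4.
exists N, (linfun (vsval : H -> 'Hom(M, X))); split.
- by apply: inj_lker0 => x y; rewrite !lfunE /=; apply: val_inj.
- apply/vspaceP => x; apply/idP/idP => [/memv_imgP[h _ ->]|hx].
    by rewrite lfunE; apply: subvsP.
  by apply/memv_imgP; exists (Subvs hx); rewrite ?memvf // lfunE.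
- by move=> x c; rewrite !lfunE [LHS]actE.
Qed.

(** Defined on all linear maps by projection, which keeps it total and linear; it is meaningful on
    [homA M M]. *)
Definition to_end (f : 'Hom(M, M)) : endalg M := vsproj (homA M M) f.

Lemma to_endK f : f \in homA M M -> vsval (to_end f) = f.
Proof. exact: vsprojK. Qed.

Section Functoriality.
Variables (N N' : rmod C) (X X' : rmod A).
Variables (b : 'Hom(N, 'Hom(M, X))) (b' : 'Hom(N', 'Hom(M, X'))).
Hypotheses (hb : corr b) (hb' : corr b').

Definition corr_map (h : 'Hom(X, X')) (u : 'Hom(N, N')) :=
  forall x, b' (u x) = (h \o b x)%VF.

Lemma corr_map_hom h : h \in homA X X' ->
  exists2 u, u \in homA N N' & corr_map h u.
Proof.
move=> hh; pose u := (b'^-1 \o hom_of_linear (@postcomp_linear K M X X' h) \o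
  b)%VF.
have uE : corr_map h u.
  move=> x; rewrite !comp_lfunE hom_of_linearE limg_lfunVK //.
  by case: hb' => _ -> _; apply: homA_comp => //; apply: corr_hom.
exists u => //; apply/homAP => x c; apply: (corr_inj hb').
by rewrite uE !corr_ract // uE comp_lfunA.
Qed.

(** Present $X$ as $M^n/T$ by its universal map. The images under [u] of the components define $h' :
    M^n \to X'$, and [key] shows that $h's$ depends only on $gs$. So $h'$ vanishes on $T$, which is
    generated by $M$. *)
Lemma corr_map_full u : gen M X -> u \in homA N N' ->
  exists2 h, h \in homA X X' & corr_map h u.
Proof.
move=> hX hu; have [n [S [i [p [g [hS hg _ glift]]]]]] :=
  universal_hom (subvv (homA M X)).
have gI := gen_universal i p hX glift.
have [T [k hk]] := kernel_exists hg.
have [hi hp _ _] := hS; have [hkh _ kI] := hk.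
have hT : gen M T.
  apply: (gen_kernel (gen_biproduct hS) hk hg) => t ht _.
  have [t' ht' t'E] := glift _ (homA_comp hpU ht).
  exists (t' \o iU)%VF; first exact: homA_comp.
  by rewrite comp_lfunA t'E -comp_lfunA pUiU comp_lfun1r.
pose x j : N := (b^-1)%VF (g \o i j)%VF.
have xE j : b (x j) = (g \o i j)%VF.
  by rewrite limg_lfunVK //; case: hb => _ -> _; apply: homA_comp.
have hf j : b' (u (x j)) \in homA M X' by apply: corr_hom.
have [h' [hh' h'E _]] := biproduct_out hS hf.
have key s y : s \in homA M S -> b y = (g \o s)%VF -> (h' \o s)%VF = b' (u y).
  move=> hs yE.
  have hps j : (p j \o s)%VF \in homA M M by apply: homA_comp.
  have -> : y = \sum_j ract (x j) (quotfun e (to_end (p j \o s)%VF) : C).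
    apply: (corr_inj hb); rewrite linear_sum yE; apply/lfunP => m.
    rewrite comp_lfunE [in LHS](biproduct_id hS (s m)) linear_sum sum_lfunE.
    apply: eq_bigr => j _ /=; case: hb => _ _ ->.
    by rewrite xE to_endK // !comp_lfunE.
  rewrite h'E !linear_sum; apply/lfunP => m; rewrite comp_lfunE !sum_lfunE.
  apply: eq_bigr => j _ /=; move/homAP: hu => ->.
  by case: hb' => _ _ ->; rewrite to_endK // !comp_lfunE.
have h'k : (h' \o k)%VF = 0.
  apply: (gen_eq0 hT) => m hm; rewrite -comp_lfunA (key _ 0) ?linear0
    ?homA_comp //.
  by apply/lfunP => y; rewrite !comp_lfunE (kernel_comp0 _ hk) zero_lfunE.
have [|h hh hE] := hom_factor hg gI hh'.
  rewrite -kI; apply/subvP => _ /memv_imgP[y _ ->].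
  by rewrite memv_ker -comp_lfunE h'k zero_lfunE.
exists h => // y; have [s hs sE] := glift _ (corr_hom y hb).
by rewrite -(key s) // -hE -comp_lfunA sE.
Qed.

Lemma surj_corr_map h u : gen M X' -> corr_map h u -> limg u = fullv ->
  limg h = fullv.
Proof.
move=> hX' hu uI; apply: hX' => m hm; have [y <-] := corr_surj hb' hm.
have [x ->] := limg_full_ex y uI; rewrite hu.
by apply/subvP => _ /memv_imgP[z _ ->]; rewrite comp_lfunE limg_memv.
Qed.

(** Since $X'$ lies in $U^\bot$, the kernel of $h$ is generated by $M$, while injectivity of [u]
    leaves no nonzero map from $M$ to it. *)
Lemma inj_corr_map h u : gen M X -> h \in homA X X' ->
  corr_map h u -> lker u = 0%VS -> lker h = 0%VS.
Proof.
move=> hX hh hu u0; have [S [k hk]] := kernel_exists hh.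
have hS := gen_kernel_perp hX (corr_perp hb') hk hh; have [hkh _ <-] := hk.
suff -> : k = 0 by apply/vspaceP => y; apply/memv_imgP/idP => [[z _ ->]|];
  rewrite ?zero_lfunE ?mem0v // memv0 => /eqP ->; exists 0;
    rewrite ?memvf ?linear0.
apply: (gen_eq0 hS) => m hm; have [x xE] := corr_surj hb (homA_comp hm hkh).
suff x0 : x = 0 by rewrite -xE x0 linear0.
apply: (lker0_inj u0); apply: (corr_inj hb'); rewrite hu xE !linear0.
by apply/lfunP => y; rewrite !comp_lfunE (kernel_comp0 _ hk) zero_lfunE.
Qed.

Lemma corr_map_eq0 h : gen M X -> corr_map h 0 -> h = 0.
Proof.
move=> hX hu; apply: (gen_eq0 hX) => m hm; have [x <-] := corr_surj hb hm.
by rewrite -hu zero_lfunE linear0.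
Qed.

End Functoriality.

Lemma quotfunMC (c d : endalg M) :
  quotfun e (c * d) = (quotfun e c : C) * quotfun e d.
Proof. exact: quotfunM. Qed.

(* X is the quotient of M^n by the images of the maps M -> M^n that are       *)
(* relations of N. A map f from M into the sum of these images is again a     *)
(* relation: up to maps that factor through the trace of U in M^n, hence      *)
(* through U^r, it is a combination of relations.                             *)
Lemma corr_dense N : exists X (b : 'Hom(N, 'Hom(M, X))), gen M X /\ corr b.
Proof.
pose n := \dim (fullv : {vspace N}).
pose x (k : 'I_n) : N := (vbasis (fullv : {vspace N}))`_k.
have [S [i [p hS]]] := biproduct_exists n M.
have [hi hp _ _] := hS; have hSgen := gen_biproduct hS.
(* The map $\mathrm{Hom}_A(M, M^n) \to N$ determined by the generators [x k]; its kernel consists of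
   the relations of [N], and [s] is a linear section of it. *)
have Llin : linear (fun f : 'Hom(M, S) =>
    \sum_k ract (x k) (quotfun e (to_end (p k \o f)%VF) : C)).
  move=> c f g; rewrite scaler_sumr -big_split; apply: eq_bigr => k _ /=.
  rewrite comp_lfunDr -comp_lfunZr /to_end linearP.
  have -> : quotfun e (c *: vsproj (homA M M) (p k \o f)%VF +
        vsproj (homA M M) (p k \o g)%VF : endalg M) =
      c *: (quotfun e (to_end (p k \o f)%VF) : C) +
        quotfun e (to_end (p k \o g)%VF).
    exact: quotfun_linear.
  by rewrite ract_linearr.
pose L := hom_of_linear Llin.
have LE f : L f = \sum_k ract (x k) (quotfun e (to_end (p k \o f)%VF) : C).
  exact: hom_of_linearE.
have Lact f (c : endalg M) : f \in homA M S ->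
  L (f \o vsval c)%VF = ract (L f) (quotfun e c : C).
  move=> hf; rewrite !LE ract_suml; apply: eq_bigr => k _.
  rewrite -ractM -quotfunMC; congr (ract _ (quotfun e _ : C)); apply: val_inj.
  have hpf : (p k \o f)%VF \in homA M M by apply: homA_comp.
  rewrite [LHS]to_endK ?comp_lfunA; first by rewrite /= to_endK.
  by apply: homA_comp => //; apply: (subvsP c).
pose s (y : N) : 'Hom(M, S) :=
  \sum_k coord (vbasis (fullv : {vspace N})) k y *: i k.
have slin : linear s.
  move=> c y z; rewrite scaler_sumr -big_split; apply: eq_bigr => k _ /=.
  by rewrite linearP scalerDl scalerA.
have hs y : s y \in homA M S by apply: memv_suml => k _; apply: memvZ.
have Ls y : L (s y) = y.
  rewrite LE [RHS](coord_vbasis (memvf y)); apply: eq_bigr => k _.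
  have -> : (p k \o s y)%VF = coord (vbasis (fullv : {vspace N})) k y *: \1%VF.
    apply/lfunP => m; rewrite comp_lfunE sum_lfunE linear_sum (bigD1 k) //=
      big1.
      by rewrite addr0 !scale_lfunE linearZ /= (biproduct_pi hS) eqxx id_lfunE.
    move=> l hl; rewrite scale_lfunE linearZ /= (biproduct_pi hS) eq_sym (negPf
      hl).
    by rewrite scaler0.
  have -> : quotfun e (to_end (coord (vbasis (fullv : {vspace N})) k y *:
    \1%VF)) =
      coord (vbasis (fullv : {vspace N})) k y *: (1 : C).
    rewrite /to_end linearZ_LR -[RHS](linearZ_LR (quotfun e)).
    congr (quotfun e (_ *: _)); apply: val_inj; rewrite [LHS]to_endK //.
    exact: homA_id.
  by rewrite linearZ /= ract1.
pose H := (lker L :&: homA M S)%VS.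
have [r [S2 [i2 [p2 [psi [hS2 hpsi psiH psilift]]]]]] :=
  universal_hom (capvSr (lker L) (homA M S)).
have hS2gen := gen_biproduct hS2; have [hi2 hp2 _ _] := hS2.
have [X [q [hq qI qK]]] := submodule_quotient (limg_submodule hpsi).
have hX : gen M X := gen_epi hq qI hSgen.
have Lpsi t : t \in homA M S2 -> L (psi \o t)%VF = 0.
  move=> ht; have -> : (psi \o t)%VF = \sum_k ((psi \o i2 k) \o (p2 k \o t))%VF.
    apply/lfunP => m; rewrite comp_lfunE [in LHS](biproduct_id hS2 (t m))
      linear_sum sum_lfunE.
    by apply: eq_bigr => k _; rewrite !comp_lfunE.
  rewrite linear_sum big1 // => k _ /=.
  have hpt : (p2 k \o t)%VF \in homA M M by apply: homA_comp.
  have := psiH k; rewrite memv_cap memv_ker => /andP[/eqP h0 hh].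
  by rewrite -(to_endK hpt) Lact // h0 ract0l.
have LU t w : t \in homA U S -> w \in homA M U -> L (t \o w)%VF = 0.
  move=> ht hw; rewrite LE big1 // => k _.
  have h1 : (p k \o t \o pU)%VF \in homA M M by do 2!apply: homA_comp => //.
  have h2 : (iU \o w)%VF \in homA M M by apply: homA_comp.
  have h3 : (p k \o (t \o w))%VF \in homA M M by do 2!apply: homA_comp => //.
  have -> : to_end (p k \o (t \o w))%VF =
      to_end (p k \o t \o pU)%VF * e * to_end (iU \o w)%VF.
    apply: val_inj; rewrite [LHS]to_endK //= !to_endK // eE -!comp_lfunA.
    by rewrite (comp_lfunA pU iU w) pUiU comp_lfun1l (comp_lfunA pU iU w) pUiU
      comp_lfun1l.
  by rewrite idempotent_ideal (linear0 (ract (x k))).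
(* This gives the injectivity of [b]: passing to $X$ introduces no new relations. *)
have claim f : f \in homA M S -> (q \o f)%VF = 0 -> L f = 0.
  move=> hf qf0.
  have fI : (limg f <= limg psi)%VS.
    by apply/subvP => _ /memv_imgP[m _ ->];
      rewrite -qK memv_ker -comp_lfunE qf0 zero_lfunE.
  have [r3 [S3 [i3 [p3 [sU [hS3 hsU _ sUlift]]]]]] :=
    universal_hom (subvv (homA U S)).
  have hS3gen : gen M S3 := genU_gen (gen_biproduct hS3).
  have [hi3 hp3 _ _] := hS3.
  have [Z [z [hz zI zK]]] := submodule_quotient (limg_submodule hsU).
  have zsU y : z (sU y) = 0 by apply/eqP; rewrite -memv_ker zK limg_memv.
  (* The kernel of [z] is the trace of $U$, hence generated by $M$; so maps $U \to Z$ lift to [S],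
     where they factor through [sU] and die in [Z]. *)
  have ZU : perpr U Z.
    apply/homA0P => t ht; have [R [k hk]] := kernel_exists hz.
    have hR : gen M R.
      by case: hk => hk k0 kI; apply: (gen_image hsU) hS3gen hk k0 _;
        rewrite kI.
    have [|t' ht' <-] := gen_liftU hR hk hz ht; first by rewrite zI subvf.
    have [t'' _ <-] := sUlift _ ht'.
    by apply/lfunP => y; rewrite !comp_lfunE zsU zero_lfunE.
  have hzpsi := homA_comp hpsi hz.
  have [R [k hk]] := kernel_exists hzpsi.
  have hR := gen_kernel_perp hS2gen ZU hk hzpsi.
  have [|t ht tE] := gen_lift hR hk hzpsi (homA_comp hf hz).
    by rewrite !limg_comp limgS.
  have hd : (f - (psi \o t))%VF \in homA M S by rewrite memvB // homA_comp.
  have [R' [k' hk']] := kernel_exists hsU.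
  have hR' : gen M R'.
    by apply: (gen_kernel hS3gen hk' hsU) => h hh _; apply: sUlift.
  (* Modulo the trace of $U$ the map [f] agrees with [psi \o t]; the difference therefore factors
     through a power of $U$, and [LU] applies. *)
  have [|d hd' dE] := gen_lift hR' hk' hsU hd.
    apply/subvP => _ /memv_imgP[m _ ->];
      rewrite -zK memv_ker add_lfunE opp_lfunE.
    by rewrite linearB /= -(comp_lfunE z f) -tE !comp_lfunE subrr.
  have -> : f = (psi \o t)%VF + (sU \o d)%VF by rewrite dE addrC subrK.
  rewrite linearD /= Lpsi // add0r.
  have -> : (sU \o d)%VF = \sum_k ((sU \o i3 k) \o (p3 k \o d))%VF.
    apply/lfunP => m; rewrite comp_lfunE [in LHS](biproduct_id hS3 (d m))
      linear_sum sum_lfunE.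
    by apply: eq_bigr => l _; rewrite !comp_lfunE.
  by rewrite linear_sum big1 // => l _ /=; apply: LU; apply: homA_comp.
have qpsi y : q (psi y) = 0 by apply/eqP; rewrite -memv_ker qK limg_memv.
have qL f : f \in homA M S -> L f = 0 -> (q \o f)%VF = 0.
  move=> hf f0; have [|f' _ <-] := psilift f;
    first by rewrite memv_cap hf memv_ker f0 eqxx.
  by apply/lfunP => m; rewrite !comp_lfunE qpsi zero_lfunE.
pose b : 'Hom(N, 'Hom(M, X)) := (hom_of_linear (@postcomp_linear K M S X q) \o
  hom_of_linear slin)%VF.
have bE y : b y = (q \o s y)%VF by rewrite comp_lfunE !hom_of_linearE.
have bL f : f \in homA M S -> b (L f) = (q \o f)%VF.
  move=> hf; apply/eqP; rewrite bE -subr_eq0.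
  have -> : (q \o s (L f))%VF - (q \o f)%VF = (q \o (s (L f) - f))%VF.
    by apply/lfunP => m; rewrite !(comp_lfunE, add_lfunE, opp_lfunE) linearB.
  by rewrite qL ?memvB // linearB /= Ls subrr.
exists X, b; split=> //; split.
- apply: inj_lker0 => y z; rewrite -[y]Ls -[z]Ls => eyz.
  apply/eqP; rewrite -subr_eq0 -linearB; apply/eqP/claim;
    first by rewrite memvB.
  move: eyz; rewrite !bL // => eyz.
  have -> : (q \o (s y - s z))%VF = (q \o s y)%VF - (q \o s z)%VF.
    by apply/lfunP => m; rewrite !(comp_lfunE, add_lfunE, opp_lfunE) linearB.
  by rewrite eyz subrr.
- apply/vspaceP => h; apply/idP/idP => [/memv_imgP[y _ ->]|hh].
    by rewrite bE homA_comp.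
  have [R [k hk]] := kernel_exists hq.
  have hR : gen M R.
    by case: hk => hk k0 kI; apply: (gen_image hpsi) hS2gen hk k0 _; rewrite kI.
  have [|f hf <-] := gen_lift hR hk hq hh; first by rewrite qI subvf.
  by rewrite -bL // limg_memv.
- move=> y c; rewrite -[in LHS](Ls y) -Lact // bL ?bE ?comp_lfunA //.
  by apply: homA_comp => //; apply: (subvsP c).
Qed.

(** The image of $T \cap U^\bot$ under $\mathrm{Hom}_A(M, -)$; that $X$ lies in $U^\bot$ is forced
    by [corr_perp]. *)
Definition corr_class (T : subcat A) : subcat C := fun N =>
  exists X (b : 'Hom(N, 'Hom(M, X))), T X /\ corr b.

Lemma corr_zero N X (b : 'Hom(N, 'Hom(M, X))) :
  gen M X -> corr b -> is_zero N <-> is_zero X.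
Proof.
move=> hX hb; rewrite !is_zeroP; split=> h x.
  have -> : x = \1%VF x by rewrite id_lfunE.
  rewrite (gen_eq0 hX (g := \1%VF)) ?zero_lfunE // => m hm.
  by have [y <-] := corr_surj hb hm; rewrite [y]h linear0 comp_lfun0r.
apply: (corr_inj hb); rewrite linear0; apply/lfunP => m.
by rewrite [b x m]h zero_lfunE.
Qed.

Lemma corr_class_zero (T : subcat A) : subcat_eq T (@is_zero K A) ->
  subcat_le T (gen M) ->
  subcat_eq (corr_class T) (@is_zero K C).
Proof.
move=> hT hTM N; split=> [[X [b [hX hb]]]|hN].
  by apply/(corr_zero (hTM _ hX) hb)/hT.
have [X [b [hX hb]]] := corr_dense N.
by exists X, b; split=> //; apply/hT/(corr_zero hX hb).
Qed.

(** Surjections and short exact sequences of $C$-modules come from surjections and short exact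
    sequences of $A$-modules, to which the closure properties of [T] apply. *)
Lemma corr_class_torsion (T : subcat A) : torsion_class T ->
  subcat_le T (gen M) ->
  torsion_class (corr_class T).
Proof.
case=> T0 Tq Te hT; split.
- move=> N hN; have [X [b [hX hb]]] := corr_dense N.
  by exists X, b; split=> //; apply/T0/(corr_zero hX hb).
- move=> N N' u hu uI [X [b [hX hb]]];
    have [X' [b' [hX' hb']]] := corr_dense N'.
  have [h hh hE] := corr_map_full hb hb' (hT _ hX) hu.
  exists X', b'; split=> //; apply: Tq hh _ hX.
  exact: (surj_corr_map hb' hX' hE uI).
move=> N1 N N2 f g hf hg f0 fg gI [X1 [b1 [hX1 hb1]]] [X2 [b2 [hX2 hb2]]].
have [X [b [hX hb]]] := corr_dense N.
have [h1 hh1 h1E] := corr_map_full hb1 hb (hT _ hX1) hf.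
have [h2 hh2 h2E] := corr_map_full hb hb2 hX hg.
have gf x : g (f x) = 0 by apply/eqP; rewrite -memv_ker -fg limg_memv.
exists X, b; split=> //; apply: (Te _ _ _ h1 h2) => //.
- exact: (inj_corr_map hb1 hb (hT _ hX1) hh1 h1E f0).
- have h0 : (h2 \o h1)%VF = 0.
    apply: (corr_map_eq0 hb1 (b' := b2)); first exact: hT.
    by move=> x; rewrite zero_lfunE linear0 -comp_lfunA -h1E -h2E gf linear0.
  have [S [k hk]] := kernel_exists hh2.
  have hS := gen_kernel_perp hX (corr_perp hb2) hk hh2; have [hkh _ kI] := hk.
  apply/eqP; rewrite eqEsubv; apply/andP; split.
    apply/subvP => _ /memv_imgP[x _ ->].
    by rewrite memv_ker -comp_lfunE h0 zero_lfunE.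
  (* The kernel of [h2] is generated by $M$, so exactness in the middle need only be tested on maps
     from $M$. *)
  rewrite -kI; have kf : (k @^-1: limg h1)%VS = fullv.
    apply: hS => m hm; have [x xE] := corr_surj hb (homA_comp hm hkh).
    have : x \in lker g.
      rewrite memv_ker; apply/eqP/(corr_inj hb2); rewrite h2E xE linear0.
      by apply/lfunP => y; rewrite !comp_lfunE (kernel_comp0 _ hk) zero_lfunE.
    rewrite -fg => /memv_imgP[x1 _ x1E]; apply/subvP => _ /memv_imgP[y _ ->].
    by rewrite -memv_preim -comp_lfunE -xE x1E h1E comp_lfunE limg_memv.
  by apply/subvP => _ /memv_imgP[y _ ->]; rewrite memv_preim kf memvf.
- exact: (surj_corr_map hb2 (hT _ hX2) h2E gI).
Qed.

Lemma corr_class_cover (T1 T2 : subcat A) : torsion_class T1 ->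
  torsion_class T2 ->
  subcat_le T2 (gen M) -> torsion_cover T1 T2 ->
  subcat_eq (corr_class T1) (corr_class T2) \/
  torsion_cover (corr_class T1) (corr_class T2).
Proof.
move=> t1 t2 hT2 [[le12 nle21] cov].
have hT1 : subcat_le T1 (gen M) by move=> X /le12 /hT2.
have le N : corr_class T1 N -> corr_class T2 N.
  by case=> X [b [hX hb]]; exists X, b; split=> //; apply: le12.
case: (classic (subcat_le (corr_class T2) (corr_class T1))) => [ge|nge].
  by left=> N; split; [apply: le | apply: ge].
right; split; first by split.
case=> S [tS [le1S nleS1] [leS2 nle2S]]; apply: nle2S => N0 hN0.
have [N h] := not_all_ex_not _ _ nleS1; have {h} [hN nN] := imply_to_and _ _ h.
have [X [b [hX hb]]] := leS2 _ hN.
have [R [N' [i [q [hR hi hq qI hN']]]]] := torsion_radical N0 tS.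
have [_ Sq _] := tS.
have [_ cq _] := corr_class_torsion t2 hT2.
have [X' [b' [hX' hb']]] := cq _ _ _ hq qI hN0.
(* [N'] is the [S]-torsion-free quotient of [N0]; once it vanishes, [N0] is its own torsion part. *)
suff N'0 : is_zero N'.
  have [hih _ iI] := hi; apply: Sq hih _ hR; rewrite iI.
  by apply/vspaceP => x; rewrite memvf memv_ker; apply/eqP/((is_zeroP _).1 N'0).
apply/(corr_zero (hT2 _ hX') hb').
(* The [T1]-torsion part of [X'] lies in $U^\bot$ and gives a module of [S] mapping to [N'], so its
   inclusion is zero: no module of [T1] maps nontrivially to [X']. *)
have [X1 [Y [j [r [hX1 hj hr rI hY]]]]] := torsion_radical X' t1.
have [hjh j0 jI] := hj.
have X1U : perpr U X1.
  apply/homA0P => t ht; apply/lfunP => y; apply: (lker0_inj j0).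
  rewrite -comp_lfunE ((homA0P _ _).1 (corr_perp hb') _ (homA_comp ht hjh)).
  by rewrite !zero_lfunE linear0.
have [N1 [b1 hb1]] := corr_exists X1U.
have [u hu uE] := corr_map_hom hb1 hb' hjh.
have u0 : u = 0 by apply: hN' hu; apply: le1S; exists X1, b1.
have jz : j = 0 by apply: (corr_map_eq0 hb1 (hT1 _ hX1) (b' := b'));
  rewrite -u0.
have rinj : injective r.
  apply: lker0_inj; rewrite -jI jz; apply/vspaceP => x; rewrite memv0.
  apply/memv_imgP/eqP => [[y _ ->]|->]; first by rewrite zero_lfunE.
  by exists 0; rewrite ?memvf ?linear0.
pose G Y := T2 Y /\ perpl X' Y.
have tG : torsion_class G := torsion_perpl X' t2.
have T1G : subcat_le T1 G.
  move=> Z hZ; split; first exact: le12.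
  apply/homA0P => f hf; apply/lfunP => z; apply: rinj.
  by rewrite -comp_lfunE (hY _ _ hZ (homA_comp hf hr)) !zero_lfunE linear0.
have GX : G X.
  split=> //; apply/homA0P => h hh; have [v hv vE] := corr_map_hom hb hb' hh.
  apply: (corr_map_eq0 hb (hT2 _ hX) (b' := b')).
  by rewrite -(hN' _ _ hN hv).
(* [X] lies in [G] but not in [T1], so otherwise [G] would be strictly between [T1] and [T2]. *)
have T2G : subcat_le T2 G.
  apply: NNPP => nG; apply: cov; exists G; split=> //; last by split=> // Z [].
  split=> // hG; apply: nN; exists X, b; split=> //; exact: hG.
have [_ /homA0P h0] := T2G _ hX'.
apply/is_zeroP => x; rewrite -[x]id_lfunE (h0 _ (homA_id X')).
exact: zero_lfunE.
Qed.

Lemma corr_maximal_green_sequence :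
  has_maximal_green_sequence (gen M) -> alg_has_maximal_green_sequence C.
Proof.
case=> m [c [c0 cm cT cC]].
have cle i : (i <= m)%N -> subcat_le (c i) (gen M).
  (* Descending induction from the top of the chain; subtraction is truncated, so the index stays at
     0 once [j] reaches [m]. *)
  move=> hi; have [j ->] : exists j, i = (m - j)%N by exists (m - i)%N;
    rewrite subKn.
  elim: j {hi} => [|j IH] X; first by rewrite subn0 => /cm.
  have [h|h] := ltnP j m.
    move=> hX; apply: IH; rewrite -(subnSK h).
    have hlt : (m - j.+1 < m)%N by rewrite ltn_subrL; case: (m) h.
    by have [[le _] _] := cC _ hlt; apply: le.
  move=> hX; apply: IH; rewrite (eqP (h : (m - j == 0)%N)).
  by move: hX; rewrite (eqP (leqW h : (m - j.+1 == 0)%N)).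
have [||i hi|l [d [d0 dl dT dC]]] :=
    @weak_maximal_green_sequence _ _ m (fun i => corr_class (c i)).
- by apply: corr_class_zero => //; apply: cle.
- by move=> i hi; apply: corr_class_torsion; [apply: cT | apply: cle].
- apply: corr_class_cover; [exact/cT/ltnW | exact: cT | exact: cle | exact: cC].
exists l, d; split=> // N; rewrite dl; split=> // _.
by have [X [b [hX hb]]] := corr_dense N; exists X, b; split=> //; apply/cm.
Qed.

End Reduction.

Theorem theorem3p16 (K : fieldType) (A : fdalg K) (hA : basic_alg A)
  (U Q M P : rmod A)
  (hUQ : tau_rigid_pair U Q) (hU : basic U) (hQ : basic Q)
  (hMP : right_bongartz_completion U Q M P)
  (e : endalg M) (he : summand_idempotent U e)
  (hmgs : has_maximal_green_sequence (Fac M)) :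
  alg_has_maximal_green_sequence (tau_tilting_reduction e).
Proof.
have [[[_ [NM hNM MNM] _] _] _ _ hFac] := hMP.
have [iU [pU [hiU hpU pUiU eE]]] := he.
(* As the empty sum, [zeromod] is in [add M]; the two Hom-vanishing conditions describing
   $\mathsf{Fac}\,M$ pass to finite direct sums. *)
have hsum n S i p : @biproduct K A n (zeromod A) S i p -> Fac M S.
  move=> hS; have [hi _ _ _] := hS.
  have : Fac M (zeromod A).
    exists (zeromod A), \1%VF; split; rewrite ?homA_id ?lim1g //.
    exists 0%N; rewrite big_ord0.
    by apply: (@retract_summand _ _ _ _ \1%VF \1%VF);
      rewrite ?homA_id ?comp_lfun1l.
  case/hFac => [[N hN /homA0P ZN] /homA0P QZ].
  have [_ hp _ _] := hS; apply/hFac; split; [exists N => // |];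
    apply/homA0P => t ht.
    apply/lfunP => x; rewrite (biproduct_id hS x) linear_sum zero_lfunE big1 //.
    by move=> k _ /=; rewrite -(comp_lfunE t) (ZN _ (homA_comp (hi k) ht))
      zero_lfunE.
  apply/lfunP => x; rewrite (biproduct_id hS (t x)) zero_lfunE big1 //.
  move=> k _; rewrite -(comp_lfunE (p k)) (QZ _ (homA_comp ht (hp k))).
  by rewrite zero_lfunE linear0.
have genZ := gen_zeromod hsum.
have FacE : subcat_eq (Fac M) (gen M).
  by move=> X; split; [apply: Fac_gen | apply: gen_Fac].
apply: (corr_maximal_green_sequence hiU hpU pUiU eE).
- move=> Y Z S k g /FacE/hFac[[N hN YN] /homA0P YQ] hk hg hlift.
  have [P1 [P0 [f [p [[_ hf hp pI] [fI ext]]]]]] := tau_presentation hN.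
  apply/FacE/hFac; split.
    exists N => //; apply/ext.
    by apply: (extends_kernel hf hp pI fI _ hk hg hlift); apply/ext.
  apply/homA0P => t ht; have [hkh k0 _] := hk; apply/lfunP => x.
  apply: (lker0_inj k0); rewrite -comp_lfunE (YQ _ (homA_comp ht hkh)).
  by rewrite !zero_lfunE linear0.
- move=> S Y Z k g h hS hk hg hh hsub.
  (* Here the presentation is that of $M$, not $U$: a module generated by $M$ has no nonzero map to
     $\tau M$ because $M$ is $\tau$-rigid. *)
  have [P1 [P0 [f [p [[hP0 hf hp pI] [fI ext]]]]]] := tau_presentation hNM.
  apply: (extends_lift hP0 hf hp pI fI _ hk hg hh hsub); apply/ext.
  apply/homA0P => t ht; apply: (gen_eq0 hS) => m hm.
  by apply: (homA0P _ _).1 MNM _ (homA_comp hm ht).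
have [m [c [c0 cm cT cC]]] := hmgs; exists m, c; split=> // X.
by rewrite cm; apply: FacE.
Qed.
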